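(* Let $\lambda\in\mathbb{T}$ and $m\in\mathbb{N}$ (with $m\ge 1$), and let $\varphi_\lambda^m\in\mathcal{N}^+$ be defined by $$\varphi_\lambda^m(z)=\frac{(\overline{\lambda}z)^m}{(1-\overline{\lambda}z)^m},\quad z\in\mathbb{D}.$$ Let $z_1,\dots,z_m\in\mathbb{D}$ be the preimages, under the Koebe function $k(z)=\frac{z}{(1-z)^2}$ on $\mathbb{D}$, of the $m$ distinct $m$-th roots of $1$ if $m$ is odd, and of the $m$ distinct $m$-th roots of $-1$ if $m$ is even. Then the canonical representation $\varphi_\lambda^m=b_\lambda/a_\lambda$ is given by $$b_\lambda(z)=\frac{C_m(\overline{\lambda}z)^m}{\prod_{k=1}^m(1-\overline{\lambda}z_kz)},\qquad a_\lambda(z)=\frac{C_m(1-\overline{\lambda}z)^m}{\prod_{k=1}^m(1-\overline{\lambda}z_kz)},\qquad\text{where } C_m=\prod_{k=1}^m(1-z_k).$$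
   Context: $\mathbb{D}$ is the open unit disc and $\mathbb{T}=\partial\mathbb{D}$. $\mathcal{N}^+$ is the Smirnov class on $\mathbb{D}$. A pair $(b,a)$ consists of a function $b$ in the closed unit ball of $H^\infty$ that is not an extreme point of it (equivalently, $\log(1-|b|^2)$ is integrable on $\mathbb{T}$) and the unique outer function $a\in H^\infty$ with $a(0)>0$ and $|a|^2+|b|^2=1$ a.e. on $\mathbb{T}$. Every nonzero $\varphi\in\mathcal{N}^+$ has a unique representation $\varphi=b/a$ with $(b,a)$ a pair; this is called the canonical representation of $\varphi$. The Koebe function $k(z)=z/(1-z)^2$ is regarded as a function on $\mathbb{D}$, where it is injective. *)

(* Defs.v *)
From HB Require Import structures.
From mathcomp Require Import all_boot all_order all_algebra.
From mathcomp Require Import complex.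
From mathcomp Require Import all_classical all_reals all_analysis.

Set Implicit Arguments.
Unset Strict Implicit.
Unset Printing Implicit Defensive.

Import Order.TTheory GRing.Theory Num.Theory.
Import numFieldNormedType.Exports.

Local Open Scope classical_set_scope.
Local Open Scope complex_scope.
Local Open Scope ring_scope.

(* The complex numbers are R[i], for R an arbitrary realType.  R[i] carries the
   topology of its norm through the alias R[i]^o, and its order is the partial
   one: x <= y means that y - x is a nonnegative real. *)

Section Disc.
Variable R : realType.
Local Notation C := R[i].

Definition disc : set C := [set z | `|z| < 1].

Definition expi (t : R) : C := cos t +i* sin t.

Definition cexp (z : C) : C := (expR (complex.Re z))%:C * expi (complex.Im z).

(* A function on the disc is a total function on R[i], of which only the values
   on the disc matter. *)
Definition holomorphic_on_disc (f : C -> C) : Prop :=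
  forall z, disc z -> derivable (f : C^o -> C^o) z 1.

Definition Hinfty (f : C -> C) : Prop :=
  holomorphic_on_disc f /\
  exists M : R, forall z, disc z -> `|f z| <= M%:C.

Definition Hinfty_ball (f : C -> C) : Prop :=
  Hinfty f /\ forall z, disc z -> `|f z| <= 1.

Definition extreme_Hinfty_ball (b : C -> C) : Prop :=
  Hinfty_ball b /\
  forall (f g : C -> C) (s : R),
    Hinfty_ball f -> Hinfty_ball g -> 0 < s < 1 ->
    (forall z, disc z -> b z = s%:C * f z + (1 - s)%:C * g z) ->
    forall z, disc z -> f z = b z /\ g z = b z.

(* Integral over the circle, for the normalized arc length measure. *)
Definition circle_integral (F : R -> C) : C :=
  ((2 * pi)^-1 *
     \int[lebesgue_measure]_(t in `[0, 2 * pi]) complex.Re (F t)) +i*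
  ((2 * pi)^-1 *
     \int[lebesgue_measure]_(t in `[0, 2 * pi]) complex.Im (F t)).

(* u is the logarithm of the modulus of f on the circle: by Fatou's theorem
   u t = ln |f (expi t)| for almost all t. *)
Definition outer (f : C -> C) : Prop :=
  exists (c : C) (u : R -> R),
    [/\ `|c| = 1,
        lebesgue_measure.-integrable `[0, 2 * pi] (EFin \o u) &
        forall z, disc z ->
          f z = c * cexp (circle_integral (fun t =>
                  (expi t + z) / (expi t - z) * (u t)%:C))].

Definition smirnov (f : C -> C) : Prop :=
  exists g h : C -> C,
    [/\ Hinfty g, Hinfty h, outer h & forall z, disc z -> f z = g z / h z].

(* w is the boundary value of f at expi t, taken as a radial limit. *)
Definition boundary_value (f : C -> C) (t : R) (w : C) : Prop :=
  (fun r : R => f (r%:C * expi t) : C^o) @ 1^'- --> (w : C^o).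

Definition pair_ba (b a : C -> C) : Prop :=
  [/\ Hinfty_ball b,
      ~ extreme_Hinfty_ball b,
      Hinfty a /\ outer a,
      0 < a 0 &
      {ae lebesgue_measure, forall t : R, t \in `[0, 2 * pi] ->
        exists wa wb : C, [/\ boundary_value a t wa, boundary_value b t wb &
                              `|wa| ^+ 2 + `|wb| ^+ 2 = 1]}].

(* Such a pair (b, a) is unique, up to the values outside of the disc. *)
Definition canonical_representation (phi b a : C -> C) : Prop :=
  [/\ smirnov phi,
      exists2 z, disc z & phi z != 0,
      pair_ba b a &
      forall z, disc z -> phi z = b z / a z].

Definition koebe (z : C) : C := z / (1 - z) ^+ 2.

End Disc.

(* Main.v *)
Require Import Defs.
From mathcomp Require Import all_boot all_order all_algebra.
From mathcomp Require Import complex ring lra.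
From mathcomp Require Import all_classical all_reals all_analysis measurable_realfun.

(** Let [y] be the conjugate of [lambda] times [x], let [C] be the product of the
    [1 - z k], and let [q y] be the product of the [1 - (z k) y]. Then
    [b = C y^m / q y] and [a = C (1 - y)^m / q y], so that [b / a] is the given
    function, and it remains to see that [(b, a)] is a pair.

    The modulus on the circle. If [|y| = 1] and [T = |1 - y|^2], then [k y = - 1 / T],
    and [(1 - z y) (1 - z y') = (1 - z)^2 (1 + k(z) T)] for the conjugate [y'] of [y].
    The [w k] are all the roots of a real polynomial, hence they are permuted by
    conjugation, and so are the [z k], since the Koebe function is injective and real
    ([prod_preimages_conj]). Therefore [|q y|^2] is the product, over all
    [z = z k], of the two sides of this identity: it is [C^2] times the product of the
    [1 + (w k) T], which is [1 + T^m] because of the signs chosen for the [w k]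
    ([normc_prod_circle]). This says that [|a|^2 + |b|^2 = 1] on
    the circle, as [C] is real. It is moreover positive: the products of the
    [1 - s (z k)], for [s] in the unit interval, are real, are not 0, and join [C] to 1
    ([prod_one_sub_gt0]).

    The function [a] is outer. Outer functions are stable under products and inverses,
    so it is enough to treat the factors [1 - c x] with [|c| <= 1], of which the one
    with [|c| = 1] vanishes on the circle. For [|c| < 1] the Taylor polynomials of
    [log (1 - c x)] converge uniformly on the closed disc, so the Herglotz formula for
    polynomials gives the representation of [1 - c z] by the mean of [ln |1 - c w|]
    against the Herglotz kernel ([exp_log_potential_lt1]). For [|c| = 1] one lets radii
    tend to 1: the mean of [ln |1 - r c w|] is 0 for all [r < 1], so Fatou's lemma makes
    [ln |1 - c w|] integrable ([log_dist_integrable]), and dominated convergence extends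
    the formula ([exp_log_potential]).

    The function [b] is in the ball and is not extreme. The functions [a] and [b] are in
    the disc algebra, where the Herglotz formula holds, hence the maximum principle, as
    the Poisson kernel is nonnegative. Applied to an inner product, it gives
    [|a|^2 + |b|^2 <= 1] in the disc ([disc_algebra_max_pair]). So [b] and [a] are in the
    ball, and even [b + a^2 / 2] and [b - a^2 / 2] are, of which [b] is the midpoint
    ([not_extreme_of_mate]).

    Finally [a] and [b] are rational functions without poles on the closed disc, so they
    have radial limits everywhere on the circle. *)

Set Implicit Arguments.
Unset Strict Implicit.

Import Order.TTheory GRing.Theory Num.Theory.
Import Normc.
Import numFieldNormedType.Exports.

Local Open Scope classical_set_scope.
Local Open Scope complex_scope.
Local Open Scope ring_scope.

Local Notation Re := (@complex.Re _).
Local Notation Im := (@complex.Im _).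
Local Notation period R := (`[0, 2 * @pi R]%classic : set R).

(** * Complex numbers, the exponential and the circle *)

Lemma complex_ReIm (R : realType) (z : R[i]) : z = Re z +i* Im z.
Proof. by case: z. Qed.

Lemma complex_ext (R : realType) (x y : R[i]) : Re x = Re y -> Im x = Im y -> x = y.
Proof. by case: x; case: y => ? ? ? ? /= -> ->. Qed.

Lemma cReM (R : realType) (x y : R[i]) : Re (x * y) = Re x * Re y - Im x * Im y.
Proof. by case: x; case: y. Qed.

Lemma cImM (R : realType) (x y : R[i]) : Im (x * y) = Re x * Im y + Im x * Re y.
Proof. by case: x; case: y. Qed.

Lemma cReD (R : realType) (x y : R[i]) : Re (x + y) = Re x + Re y.
Proof. by case: x; case: y. Qed.

Lemma cImD (R : realType) (x y : R[i]) : Im (x + y) = Im x + Im y.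
Proof. by case: x; case: y. Qed.

Lemma cReN (R : realType) (x : R[i]) : Re (- x) = - Re x.
Proof. by case: x. Qed.

Lemma cImN (R : realType) (x : R[i]) : Im (- x) = - Im x.
Proof. by case: x. Qed.

Lemma cReJ (R : realType) (x : R[i]) : Re (x^*) = Re x.
Proof. by case: x. Qed.

Lemma cImJ (R : realType) (x : R[i]) : Im (x^*) = - Im x.
Proof. by case: x. Qed.

Lemma norm_normc (R : realType) (z : R[i]) : `|z| = (normc z)%:C.
Proof. by []. Qed.

Lemma normc_opp (R : realType) (x : R[i]) : normc (- x) = normc x.
Proof. by case: x => a b /=; rewrite !sqrrN. Qed.

Lemma ler_normcD (R : realType) (x y : R[i]) : normc (x + y) <= normc x + normc y.
Proof. by rewrite -lecR rmorphD/= -!norm_normc ler_normD. Qed.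

Lemma normc_ge0 (R : realType) (x : R[i]) : 0 <= normc x.
Proof. by rewrite -lecR -norm_normc normr_ge0. Qed.

Lemma normc_conj (R : realType) (x : R[i]) : normc (x^*) = normc x.
Proof. by case: x => a b /=; rewrite !sqrrN. Qed.

Lemma normc_realE (R : realType) (x : R) : normc (x%:C) = `|x|.
Proof. by rewrite /= expr0n addr0 sqrtr_sqr. Qed.

Lemma normcX (R : realType) (x : R[i]) n : normc (x ^+ n) = normc x ^+ n.
Proof. by elim: n => [|n IH]; rewrite ?expr0 ?normc1// !exprS normcM IH. Qed.

Lemma sqr_normcE (R : realType) (x : R[i]) : normc x ^+ 2 = Re x ^+ 2 + Im x ^+ 2.
Proof. by case: x => a b /=; rewrite sqr_sqrtr// addr_ge0 ?sqr_ge0. Qed.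

Lemma Re_le_normc (R : realType) (x : R[i]) : `|Re x| <= normc x.
Proof.
by rewrite -[leRHS]ger0_norm ?normc_ge0// -ler_sqr ?nnegrE// !real_normK ?num_real//
  sqr_normcE lerDl sqr_ge0.
Qed.

Lemma Im_le_normc (R : realType) (x : R[i]) : `|Im x| <= normc x.
Proof.
by rewrite -[leRHS]ger0_norm ?normc_ge0// -ler_sqr ?nnegrE// !real_normK ?num_real//
  sqr_normcE lerDr sqr_ge0.
Qed.

Lemma normc_le_ReIm (R : realType) (x : R[i]) : normc x <= `|Re x| + `|Im x|.
Proof.
rewrite [x in normc x]complexE; apply: le_trans (ler_normcD _ _) _.
by rewrite normcM !normc_realE /= expr0n expr1n add0r sqrtr1 mul1r.
Qed.

Lemma normc_gt0 (R : realType) (x : R[i]) : (0 < normc x) = (x != 0).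
Proof. by rewrite -ltcR -norm_normc normr_gt0. Qed.

Lemma normc_distC (R : realType) (x y : R[i]) : normc (x - y) = normc (y - x).
Proof. by rewrite -normc_opp opprB. Qed.

(** Turns approximation arguments into equalities: every identity between a mean and a
    value is obtained by making the error of a polynomial approximation small. *)
Lemma normc_le_eps (R : realType) (x : R[i]) (A : R) :
  0 <= A -> (forall e, 0 < e -> normc x <= A * e) -> x = 0.
Proof.
move=> A0 H; apply: eq0_normc; apply/eqP; rewrite eq_le normc_ge0 andbT.
apply/ler_addgt0Pr => e e0; rewrite add0r.
have A1 : 0 < A + 1 by apply: ltr_wpDl.
have := H (e / (A + 1)) (divr_gt0 e0 A1) => /le_trans; apply.
rewrite mulrCA; apply: ler_piMr; first exact: ltW.
by rewrite ler_pdivrMr// mul1r lerDl.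
Qed.

Lemma normcM_lt1 (R : realType) (x y : R[i]) :
  normc x < 1 -> normc y <= 1 -> normc (x * y) < 1.
Proof.
move=> x1 y1; rewrite normcM; apply: le_lt_trans x1.
by rewrite ler_piMr// normc_ge0.
Qed.

Lemma one_sub_neq0 (R : realType) (x : R[i]) : normc x < 1 -> 1 - x != 0.
Proof.
move=> x1; rewrite subr_eq0; apply/eqP => E.
by rewrite -E normc1 ltxx in x1.
Qed.

Lemma normc_one_sub_ge (R : realType) (x : R[i]) : 1 - normc x <= normc (1 - x).
Proof.
rewrite lerBlDr; apply: le_trans (ler_normcD _ _).
by rewrite subrK normc1.
Qed.

Lemma normc_one_sub_le2 (R : realType) (x : R[i]) : normc x <= 1 -> normc (1 - x) <= 2.
Proof.
by move=> x1; apply: le_trans (ler_normcD _ _) _; rewrite normc_opp normc1; lra.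
Qed.

Lemma invcE (R : realType) (x : R[i]) :
  x^-1 = (normc x ^+ 2)^-1%:C * x^*.
Proof.
rewrite sqr_normcE; case: x => a b; apply: complex_ext => /=.
  by rewrite mul0r subr0 mulrC.
by rewrite mul0r addr0 mulrN mulrC.
Qed.

Lemma discE_normc (R : realType) (z : R[i]) : disc z <-> normc z < 1.
Proof. by rewrite /disc/= norm_normc -[1]/(1%:C) ltcR. Qed.

Lemma exists_expr_le (R : realType) (rho e : R) :
  0 <= rho < 1 -> 0 < e -> exists N, rho ^+ N <= e.
Proof.
move=> /andP[r0 r1] e0.
have : (fun n => rho ^+ n) @ \oo --> (0 : R) by apply: cvg_expr; rewrite ger0_norm.
move=> /cvgrPdist_le /(_ e e0) [N _ /(_ N (leqnn N))] /=.
rewrite sub0r normrN ger0_norm ?exprn_ge0// => H; by exists N.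
Qed.

Lemma expiD (R : realType) (s t : R) : expi (s + t) = expi s * expi t.
Proof. by apply: complex_ext; rewrite ?cReM ?cImM/= ?cosD// sinD addrC. Qed.

Lemma expiX (R : realType) (t : R) n : expi t ^+ n = expi (n%:R * t).
Proof.
elim: n => [|n IH]; first by rewrite expr0 mul0r /expi cos0 sin0.
by rewrite exprS IH -expiD -natr1 mulrDl mul1r addrC.
Qed.

Lemma normc_expi (R : realType) (t : R) : normc (expi t) = 1.
Proof. by rewrite /= cos2Dsin2 sqrtr1. Qed.

Lemma normc_expi_le1 (R : realType) (t : R) : normc (expi t) <= 1.
Proof. by rewrite normc_expi. Qed.

Lemma normcM_expi (R : realType) (a : R[i]) t : normc (a * expi t) = normc a.
Proof. by rewrite normcM normc_expi mulr1. Qed.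

Lemma expi_neq0 (R : realType) (t : R) : expi t != 0.
Proof. by rewrite -normc_gt0 normc_expi. Qed.

Lemma expiJ (R : realType) (t : R) : (expi t)^* = (expi t)^-1.
Proof. by rewrite invcE normc_expi expr1n invr1 mul1r. Qed.

Lemma expi_sub_neq0 (R : realType) (z : R[i]) (t : R) :
  normc z < 1 -> expi t - z != 0.
Proof.
move=> z1; rewrite subr_eq0; apply/eqP => E.
by rewrite -E normc_expi ltxx in z1.
Qed.

Lemma cexpD (R : realType) (x y : R[i]) : cexp (x + y) = cexp x * cexp y.
Proof.
by rewrite /cexp cReD cImD expRD expiD rmorphM/=; ring.
Qed.

Lemma cexp0 (R : realType) : cexp 0 = 1 :> R[i].
Proof. by rewrite /cexp/= expR0 /expi cos0 sin0 mul1r. Qed.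

Lemma normc_cexp (R : realType) (x : R[i]) : normc (cexp x) = expR (Re x).
Proof. by rewrite normcM normc_expi mulr1 normc_realE ger0_norm// expR_ge0. Qed.

Lemma cexpN (R : realType) (x : R[i]) : cexp (- x) * cexp x = 1.
Proof. by rewrite -cexpD addNr cexp0. Qed.

(** * Means over the circle *)

Definition circle_integrable (R : realType) (f : R -> R) :=
  lebesgue_measure.-integrable (period R) (EFin \o f).

Definition circle_mean (R : realType) (f : R -> R) : R :=
  (2 * pi)^-1 * \int[lebesgue_measure]_(t in period R) f t.

Lemma measurable_period (R : realType) : measurable (period R : set (measurableTypeR R)).
Proof. exact: measurable_itv. Qed.

Lemma measure_period (R : realType) : lebesgue_measure (period R) = (2 * pi)%:E.
Proof.
by rewrite lebesgue_measure_itv /= lte_fin mulr_gt0 ?pi_gt0// -EFinB subr0.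
Qed.

Lemma circle_meanD (R : realType) (f g : R -> R) :
  circle_integrable f -> circle_integrable g ->
  circle_mean (fun t => f t + g t) = circle_mean f + circle_mean g.
Proof.
by move=> fi gi; rewrite /circle_mean -mulrDr -RintegralD//; exact: measurable_period.
Qed.

Lemma circle_meanZ (R : realType) (c : R) (f : R -> R) :
  circle_integrable f -> circle_mean (fun t => c * f t) = c * circle_mean f.
Proof.
move=> fi; rewrite /circle_mean RintegralZl//.
by rewrite mulrCA.
Qed.

Lemma circle_mean_cst (R : realType) (c : R) : circle_mean (fun=> c) = c.
Proof.
rewrite /circle_mean Rintegral_cst//.
have -> : fine (lebesgue_measure (period R)) = 2 * pi :> R by rewrite measure_period.
by rewrite mulrCA mulVf ?mulr1// gt_eqF// mulr_gt0// pi_gt0.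
Qed.

Lemma eq_circle_mean (R : realType) (f g : R -> R) :
  (forall t, t \in `[0, 2 * pi] -> f t = g t) -> circle_mean f = circle_mean g.
Proof.
move=> fg; congr (_ * _); apply: eq_Rintegral => t.
by rewrite inE/= => /fg.
Qed.

Lemma le_circle_mean (R : realType) (f g : R -> R) :
  circle_integrable f -> circle_integrable g ->
  (forall t, t \in `[0, 2 * pi] -> f t <= g t) ->
  circle_mean f <= circle_mean g.
Proof.
move=> fi gi fg; rewrite /circle_mean ler_wpM2l//.
  by rewrite invr_ge0 mulr_ge0// pi_ge0.
by apply: le_Rintegral => //; exact: measurable_period.
Qed.

Lemma circle_integrableD (R : realType) (f g : R -> R) :
  circle_integrable f -> circle_integrable g ->
  circle_integrable (fun t => f t + g t).
Proof.
move=> fi gi; have := integrableD (@measurable_period R) fi gi.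
by congr (_.-integrable _ _); apply/funext.
Qed.

Lemma circle_integrableZ (R : realType) (c : R) (f : R -> R) :
  circle_integrable f -> circle_integrable (fun t => c * f t).
Proof.
move=> fi; have := integrableZl (@measurable_period R) c fi.
by congr (_.-integrable _ _); apply/funext.
Qed.

Lemma continuous_bounded_period (R : realType) (f : R -> R) :
  continuous f -> [bounded f t | t in period R].
Proof.
move=> cf; have : compact (f @` period R).
  apply: continuous_compact; last exact: segment_compact.
  exact: continuous_subspaceT.
move=> /compact_bounded [M [Mr HM]]; exists M; split => // x Mx t It.
by apply: (HM x Mx); exists t.
Qed.

Lemma continuous_measurable_period (R : realType) (f : R -> R) :
  continuous f -> measurable_fun (period R) f.
Proof.
move=> cf; apply: (@measurable_funS _ _ _ _ setT) => //.
exact: measurable_realfun.continuous_measurable_fun.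
Qed.

Lemma continuous_circle_integrable (R : realType) (f : R -> R) :
  continuous f -> circle_integrable f.
Proof.
move=> cf; apply: continuous_compact_integrable; first exact: segment_compact.
exact: continuous_subspaceT.
Qed.

(** A continuous kernel is bounded on the compact period, so it may multiply an
    unbounded density such as the logarithm of a distance. *)
Lemma circle_integrableM (R : realType) (f g : R -> R) :
  continuous f -> circle_integrable g -> circle_integrable (fun t => f t * g t).
Proof.
move=> cf gi.
have := integrableMr (@measurable_period R) (continuous_measurable_period cf)
  (continuous_bounded_period cf) gi.
by congr (_.-integrable _ _); apply/funext.
Qed.

Definition ccont (R : realType) (F : R -> R[i]) :=
  continuous (fun t => Re (F t)) /\ continuous (fun t => Im (F t)).

Definition cintegrable (R : realType) (F : R -> R[i]) :=
  circle_integrable (fun t => Re (F t)) /\ circle_integrable (fun t => Im (F t)).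

Lemma ccont_cst (R : realType) (c : R[i]) : ccont (fun=> c).
Proof. by split => t; exact: cvg_cst. Qed.

Lemma ccont_expi (R : realType) : ccont (@expi R).
Proof. by split; [exact: continuous_cos|exact: continuous_sin]. Qed.

Lemma ccontD (R : realType) (F G : R -> R[i]) :
  ccont F -> ccont G -> ccont (fun t => F t + G t).
Proof.
move=> [F1 F2] [G1 G2]; split => t.
  under eq_fun do rewrite cReD.
  exact: continuousD (F1 t) (G1 t).
under eq_fun do rewrite cImD.
  exact: continuousD (F2 t) (G2 t).
Qed.

Lemma ccontM (R : realType) (F G : R -> R[i]) :
  ccont F -> ccont G -> ccont (fun t => F t * G t).
Proof.
move=> [F1 F2] [G1 G2]; split => t.
  under eq_fun do rewrite cReM.
  exact: continuousB (continuousM (F1 t) (G1 t)) (continuousM (F2 t) (G2 t)).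
under eq_fun do rewrite cImM.
  exact: continuousD (continuousM (F1 t) (G2 t)) (continuousM (F2 t) (G1 t)).
Qed.

Lemma ccontJ (R : realType) (F : R -> R[i]) : ccont F -> ccont (fun t => (F t)^*).
Proof.
move=> [F1 F2]; split => t.
  under eq_fun do rewrite cReJ.
  exact: F1.
under eq_fun do rewrite cImJ.
  apply: cvgN; exact: F2.
Qed.

Lemma ccontV (R : realType) (F : R -> R[i]) :
  ccont F -> (forall t, F t != 0) -> ccont (fun t => (F t)^-1).
Proof.
move=> cF F0.
have -> : (fun t => (F t)^-1) = (fun t => (normc (F t) ^+ 2)^-1%:C * (F t)^*).
  by apply/funext => t; rewrite invcE.
apply: ccontM; last exact: ccontJ.
have cN : continuous (fun x => normc (F x) ^+ 2).
  have -> : (fun x => normc (F x) ^+ 2) =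
      (fun x => Re (F x) * Re (F x) + Im (F x) * Im (F x)).
    by apply/funext => x; rewrite sqr_normcE -!expr2.
  case: cF => c1 c2 t.
  exact: continuousD (continuousM (c1 t) (c1 t)) (continuousM (c2 t) (c2 t)).
suff cV : continuous (fun t => (normc (F t) ^+ 2)^-1).
  by split => t; [exact: cV|exact: cvg_cst].
move=> t.
have n0 : normc (F t) ^+ 2 != 0 by rewrite sqrf_eq0 gt_eqF// normc_gt0.
exact: (@continuousV _ _ _ t n0 (cN t)).
Qed.

Lemma ccontR (R : realType) (f : R -> R) : continuous f -> ccont (fun t => (f t)%:C).
Proof. by move=> cf; split => // t; exact: cvg_cst. Qed.

Lemma ccont_integrable (R : realType) (F : R -> R[i]) : ccont F -> cintegrable F.
Proof. by move=> [c1 c2]; split; exact: continuous_circle_integrable. Qed.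

Lemma ccont_integrableM (R : realType) (F : R -> R[i]) (u : R -> R) :
  ccont F -> circle_integrable u -> cintegrable (fun t => F t * (u t)%:C).
Proof.
move=> [c1 c2] ui; split.
  under eq_fun do rewrite cReM mulr0 subr0.
  exact: circle_integrableM.
under eq_fun do rewrite cImM mulr0 add0r.
  exact: circle_integrableM.
Qed.

Lemma circle_integralE (R : realType) (F : R -> R[i]) :
  circle_integral F = circle_mean (fun t => Re (F t)) +i* circle_mean (fun t => Im (F t)).
Proof. by []. Qed.

Lemma eq_circle_integral (R : realType) (F G : R -> R[i]) :
  (forall t, t \in `[0, 2 * pi] -> F t = G t) -> circle_integral F = circle_integral G.
Proof.
by move=> FG; rewrite !circle_integralE; congr (_ +i* _);
  apply: eq_circle_mean => t It; rewrite FG.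
Qed.

Lemma circle_integralD (R : realType) (F G : R -> R[i]) :
  cintegrable F -> cintegrable G ->
  circle_integral (fun t => F t + G t) = circle_integral F + circle_integral G.
Proof.
move=> [F1 F2] [G1 G2]; rewrite !circle_integralE; apply: complex_ext => /=.
  under eq_fun do rewrite cReD.
  exact: circle_meanD.
under eq_fun do rewrite cImD.
  exact: circle_meanD.
Qed.

Lemma cintegrableD (R : realType) (F G : R -> R[i]) :
  cintegrable F -> cintegrable G -> cintegrable (fun t => F t + G t).
Proof.
move=> [F1 F2] [G1 G2]; split.
  under eq_fun do rewrite cReD.
  exact: circle_integrableD.
under eq_fun do rewrite cImD.
  exact: circle_integrableD.
Qed.

Lemma circle_integralZ (R : realType) (c : R[i]) (F : R -> R[i]) :
  cintegrable F -> circle_integral (fun t => c * F t) = c * circle_integral F.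
Proof.
move=> [F1 F2]; rewrite !circle_integralE; apply: complex_ext => /=.
  rewrite cReM/= -!mulNr -!circle_meanZ//.
  rewrite -circle_meanD; [|exact: circle_integrableZ..].
  by congr (circle_mean _); apply/funext => t; rewrite cReM mulNr.
rewrite cImM/= -!circle_meanZ// -circle_meanD; [|exact: circle_integrableZ..].
by congr (circle_mean _); apply/funext => t; rewrite cImM.
Qed.

Lemma cintegrableZ (R : realType) (c : R[i]) (F : R -> R[i]) :
  cintegrable F -> cintegrable (fun t => c * F t).
Proof.
move=> [F1 F2]; split.
  under eq_fun do rewrite cReM -mulNr.
  by apply: circle_integrableD; exact: circle_integrableZ.
under eq_fun do rewrite cImM.
by apply: circle_integrableD; exact: circle_integrableZ.
Qed.

Lemma cintegrableB (R : realType) (F G : R -> R[i]) :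
  cintegrable F -> cintegrable G -> cintegrable (fun t => F t - G t).
Proof.
move=> Fi Gi; under eq_fun do rewrite -mulN1r.
by apply: cintegrableD => //; exact: cintegrableZ.
Qed.

Lemma circle_integralB (R : realType) (F G : R -> R[i]) :
  cintegrable F -> cintegrable G ->
  circle_integral (fun t => F t - G t) = circle_integral F - circle_integral G.
Proof.
move=> Fi Gi; under eq_fun do rewrite -mulN1r.
by rewrite circle_integralD ?circle_integralZ ?mulN1r//; exact: cintegrableZ.
Qed.

Lemma circle_integralJ (R : realType) (F : R -> R[i]) :
  cintegrable F -> circle_integral (fun t => (F t)^*) = (circle_integral F)^*.
Proof.
move=> [F1 F2]; rewrite !circle_integralE; apply: complex_ext => /=.
  by under eq_fun do rewrite cReJ.
under eq_fun do rewrite cImJ -mulN1r.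
  by rewrite circle_meanZ// mulN1r.
Qed.

Lemma circle_integral_cst (R : realType) (c : R[i]) : circle_integral (fun=> c) = c.
Proof. by rewrite circle_integralE !circle_mean_cst -complex_ReIm. Qed.

(** The factor 2 comes from estimating the real and the imaginary parts separately;
    only the tendency to 0 with [M] matters. *)
Lemma circle_integral_bound (R : realType) (F : R -> R[i]) (M : R) :
  cintegrable F -> (forall t, t \in `[0, 2 * pi] -> normc (F t) <= M) ->
  normc (circle_integral F) <= 2 * M.
Proof.
have cst_int c : circle_integrable (fun=> c : R).
  by apply: continuous_circle_integrable => x; exact: cvg_cst.
have bound (f : R -> R) : circle_integrable f ->
    (forall t, t \in `[0, 2 * pi] -> `|f t| <= M) -> `|circle_mean f| <= M.
  move=> fi fM; rewrite ler_norml; apply/andP; split.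
    rewrite -[leLHS]circle_mean_cst; apply: le_circle_mean => // t /fM.
    by rewrite ler_norml => /andP[].
  rewrite -[leRHS]circle_mean_cst; apply: le_circle_mean => // t /fM.
  by rewrite ler_norml => /andP[].
move=> [F1 F2] FM; apply: le_trans (normc_le_ReIm _) _ => /=.
have -> : 2 * M = M + M by ring.
apply: lerD; apply: bound => // t It.
  exact: le_trans (Re_le_normc _) (FM _ It).
exact: le_trans (Im_le_normc _) (FM _ It).
Qed.

(** The only mean computed from antiderivatives; all the others are reduced to this
    one by algebra and approximation. *)
Lemma circle_integral_expiX (R : realType) n :
  circle_integral (fun t : R => expi t ^+ n) = (n == 0%N)%:R.
Proof.
case: n => [|n]; first by under eq_fun do rewrite expr0; rewrite circle_integral_cst.
under eq_fun do rewrite expiX.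
have p0 : 0 < 2 * pi :> R by rewrite mulr_gt0// pi_gt0.
have n0 : n.+1%:R != 0 :> R by rewrite pnatr_eq0.
have ftc (f F : R -> R) : continuous f -> (forall t, is_derive t (1:R) F (f t)) ->
    F (2 * pi) = F 0 -> circle_mean f = 0.
  move=> cf dF FF; rewrite /circle_mean /Rintegral (@continuous_FTC2 _ f F)//.
  - by rewrite FF -EFinB subrr mulr0.
  - exact: continuous_subspaceT.
  - have cF t : {for t, continuous F}.
      by apply: differentiable_continuous; apply/derivable1_diffP; have [] := dF t.
    split; first by move=> t _; have [] := dF t.
      by apply: cvg_at_right_filter; exact: cF.
    by apply: cvg_at_left_filter; exact: cF.
  - by move=> t _; rewrite derive1E; have [_ ->] := dF t.
have per k : cos (k%:R * (2 * pi)) = 1 :> R /\ sin (k%:R * (2 * pi)) = 0 :> R.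
  elim: k => [|k [c s]]; first by rewrite mul0r cos0 sin0.
  rewrite -natr1 mulrDl mul1r cosD sinD c s mulr_natl cos2pi sin2pi.
  by rewrite !mulr0 !mul0r !mulr1 subr0 addr0.
rewrite circle_integralE; apply: complex_ext => /=.
  apply: (ftc _ (fun t => n.+1%:R^-1 * sin (n.+1%:R * t))).
  - by move=> t; apply: continuous_comp; [exact: mulrl_continuous|exact: continuous_cos].
  - by move=> t; apply: is_derive_eq; rewrite /GRing.scale/=; field.
  - by rewrite (per _).2 !mulr0 sin0 mulr0.
apply: (ftc _ (fun t => - n.+1%:R^-1 * cos (n.+1%:R * t))).
- by move=> t; apply: continuous_comp; [exact: mulrl_continuous|exact: continuous_sin].
- by move=> t; apply: is_derive_eq; rewrite /GRing.scale/=; field.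
- by rewrite (per _).1 mulr0 cos0.
Qed.

(** * The disc algebra *)

(** The disc algebra, described as the uniform closure of the polynomials on the
    closed disc. Continuity on the circle is recorded so that the means below exist at
    once. *)
Definition disc_algebra (R : realType) (F : R[i] -> R[i]) : Prop :=
  ccont (fun t => F (expi t)) /\
  forall e : R, 0 < e ->
    exists p : {poly R[i]}, forall x, normc x <= 1 -> normc (F x - p.[x]) <= e.

Lemma ccont_horner (R : realType) (p : {poly R[i]}) : ccont (fun t : R => p.[expi t]).
Proof.
elim/poly_ind: p => [|p c IH].
  under eq_fun do rewrite horner0.
  exact: ccont_cst.
under eq_fun do rewrite hornerMXaddC.
by apply: ccontD; [apply: ccontM => //; exact: ccont_expi|exact: ccont_cst].
Qed.

Lemma bounded_horner (R : realType) (p : {poly R[i]}) :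
  exists2 M : R, 0 <= M & forall x, normc x <= 1 -> normc p.[x] <= M.
Proof.
elim/poly_ind: p => [|p c [M M0 IH]].
  by exists 0 => // x _; rewrite horner0 normc0.
exists (M + normc c); first by rewrite addr_ge0// normc_ge0.
move=> x x1; rewrite hornerMXaddC; apply: le_trans (ler_normcD _ _) _.
rewrite lerD2r normcM; apply: le_trans (IH _ x1).
by rewrite ler_piMr// normc_ge0.
Qed.

Lemma disc_algebra_horner (R : realType) (p : {poly R[i]}) :
  disc_algebra (fun x => p.[x]).
Proof.
split; first exact: ccont_horner.
by move=> e e0; exists p => x _; rewrite subrr normc0 ltW.
Qed.

Lemma disc_algebra_bounded (R : realType) (F : R[i] -> R[i]) : disc_algebra F ->
  exists2 M : R, 0 <= M & forall x, normc x <= 1 -> normc (F x) <= M.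
Proof.
move=> [_ /(_ _ ltr01) [p Fp]]; have [M M0 pM] := bounded_horner p.
exists (M + 1); first by rewrite addr_ge0.
move=> x x1; rewrite -[F x](subrK p.[x]) addrC.
by apply: le_trans (ler_normcD _ _) _; apply: lerD; [exact: pM|exact: Fp].
Qed.

Lemma disc_algebra_cst (R : realType) (c : R[i]) : disc_algebra (fun=> c).
Proof.
have := disc_algebra_horner c%:P; congr disc_algebra.
by apply/funext => x; rewrite hornerC.
Qed.

Lemma disc_algebra_id (R : realType) : disc_algebra (fun x : R[i] => x).
Proof.
have := disc_algebra_horner ('X : {poly R[i]}); congr disc_algebra.
by apply/funext => x; rewrite hornerX.
Qed.

Lemma disc_algebraD (R : realType) (F G : R[i] -> R[i]) :
  disc_algebra F -> disc_algebra G -> disc_algebra (fun x => F x + G x).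
Proof.
move=> [cF aF] [cG aG]; split; first exact: ccontD.
move=> e e0; have e20 : 0 < e / 2 by rewrite divr_gt0.
have [p Fp] := aF _ e20; have [q Gq] := aG _ e20; exists (p + q) => x x1.
rewrite hornerD (_ : _ - _ = (F x - p.[x]) + (G x - q.[x])); last by ring.
apply: le_trans (ler_normcD _ _) _.
by rewrite [leRHS](splitr e) lerD ?Fp ?Gq.
Qed.

(** With [|F| <= M] and [|G| <= N], approximations within [d <= 1] give a product
    within [M d + d (N + 1)], whence the choice of [d]. *)
Lemma disc_algebraM (R : realType) (F G : R[i] -> R[i]) :
  disc_algebra F -> disc_algebra G -> disc_algebra (fun x => F x * G x).
Proof.
move=> dF dG; have [M M0 FM] := disc_algebra_bounded dF.
have [N N0 GN] := disc_algebra_bounded dG.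
case: dF dG => [cF aF] [cG aG]; split; first exact: ccontM.
move=> e e0.
have K0 : 0 < M + N + 1 by rewrite ltr_wpDl// addr_ge0.
pose d := Num.min 1 (e / (M + N + 1)).
have d0 : 0 < d by rewrite lt_min ltr01 divr_gt0.
have [p Fp] := aF _ d0; have [q Gq] := aG _ d0; exists (p * q) => x x1.
rewrite hornerM.
have -> : F x * G x - p.[x] * q.[x] =
    (F x) * (G x - q.[x]) + (F x - p.[x]) * (G x - (G x - q.[x])) by ring.
apply: le_trans (ler_normcD _ _) _; rewrite !normcM.
have d1 : d <= 1 by rewrite ge_min lexx.
have dK : d * (M + N + 1) <= e.
  by rewrite -ler_pdivlMr// ge_min lexx orbT.
apply: le_trans dK.
have -> : d * (M + N + 1) = M * d + d * (N + 1) by ring.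
apply: lerD; first by apply: ler_pM; rewrite ?normc_ge0 ?FM ?Gq.
apply: ler_pM; rewrite ?normc_ge0 ?Fp//.
apply: le_trans (ler_normcD _ _) _.
by rewrite normc_opp lerD ?GN// (le_trans (Gq _ x1)).
Qed.

Lemma disc_algebraX (R : realType) (F : R[i] -> R[i]) n :
  disc_algebra F -> disc_algebra (fun x => F x ^+ n).
Proof.
move=> dF; elim: n => [|n IH].
  under eq_fun do rewrite expr0.
  exact: disc_algebra_cst.
under eq_fun do rewrite exprS.
exact: disc_algebraM.
Qed.

Lemma disc_algebra_prod (R : realType) (I : Type) (r : seq I) (f : I -> R[i] -> R[i]) :
  (forall i, disc_algebra (f i)) -> disc_algebra (fun x => \prod_(i <- r) f i x).
Proof.
move=> fi; elim: r => [|i r IH].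
  under eq_fun do rewrite big_nil.
  exact: disc_algebra_cst.
under eq_fun do rewrite big_cons.
exact: disc_algebraM.
Qed.

(** The [N]-th partial sum of the geometric series leaves the error
    [(b x)^N / (1 - b x)], at most [|b|^N / (1 - |b|)] on the closed disc. *)
Lemma disc_algebra_geom (R : realType) (b : R[i]) : normc b < 1 ->
  disc_algebra (fun x => (1 - b * x)^-1).
Proof.
move=> b1; split.
  apply: ccontV.
    apply: (@ccontD _ (fun=> 1) (fun t => - (b * expi t))); first exact: ccont_cst.
    under eq_fun do rewrite -mulNr.
    by apply: ccontM; [exact: ccont_cst|exact: ccont_expi].
  by move=> t; apply/one_sub_neq0/normcM_lt1 => //; rewrite normc_expi.
move=> e e0; have r1 : 0 < 1 - normc b by rewrite subr_gt0.
have [||N HN] := @exists_expr_le R (normc b) (e * (1 - normc b)).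
- by rewrite normc_ge0.
- by rewrite mulr_gt0.
exists (\sum_(i < N) (b ^+ i) *: 'X^i) => x x1.
have bx : normc (b * x) < 1 by exact: normcM_lt1.
have n0 := one_sub_neq0 bx.
rewrite horner_sum.
have -> : \sum_(i < N) (b ^+ i *: 'X^i).[x] = (1 - (b * x) ^+ N) / (1 - b * x).
  rewrite -[X in _ = (X - _) / _](expr1n _ N) subrXX mulrC mulKf//.
  by apply: eq_bigr => i _; rewrite hornerZ hornerXn expr1n mul1r exprMn.
have -> : (1 - b * x)^-1 - (1 - (b * x) ^+ N) / (1 - b * x)
    = (b * x) ^+ N / (1 - b * x) by rewrite mulrBl mul1r subKr.
rewrite normcM normcV ler_pdivrMr ?normc_gt0//.
have h1 : normc ((b * x) ^+ N) <= normc b ^+ N.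
  rewrite normcX; apply: lerXn2r; rewrite ?nnegrE ?normc_ge0// normcM.
  by rewrite ler_piMr// normc_ge0.
apply: le_trans h1 (le_trans HN _).
apply: ler_wpM2l; first exact: ltW.
apply: le_trans (normc_one_sub_ge _); rewrite lerD2l lerN2 normcM.
by rewrite ler_piMr// normc_ge0.
Qed.

Lemma circle_integral_horner (R : realType) (p : {poly R[i]}) :
  circle_integral (fun t => p.[expi t]) = p.[0].
Proof.
suff H n : circle_integral (fun t => p.[expi t] * expi t ^+ n) = p.[0] * (n == 0%N)%:R.
  have := H 0%N; rewrite mulr1 => <-.
  by congr circle_integral; apply/funext => t; rewrite expr0 mulr1.
elim/poly_ind: p n => [|p c IH] n.
  under eq_fun do rewrite horner0 mul0r.
  by rewrite circle_integral_cst horner0 mul0r.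
under eq_fun do rewrite hornerMXaddC mulrDl -mulrA -exprS.
have cX k : ccont (fun t : R => expi t ^+ k).
  have := ccont_horner ('X^k : {poly R[i]}).
  by under eq_fun do rewrite hornerXn.
rewrite circle_integralD; last 2 first.
- by apply: ccont_integrable; apply: ccontM => //; exact: ccont_horner.
- by apply: cintegrableZ; exact: ccont_integrable.
rewrite IH circle_integralZ ?circle_integral_expiX//; last exact: ccont_integrable.
by rewrite hornerMXaddC !mulr0 !add0r.
Qed.

(** The mean value property holds for monomials and survives uniform limits. *)
Lemma circle_integral_disc_algebra (R : realType) (F : R[i] -> R[i]) :
  disc_algebra F -> circle_integral (fun t => F (expi t)) = F 0.
Proof.
move=> [cF aF]; apply/eqP; rewrite -subr_eq0; apply/eqP.
apply: (@normc_le_eps _ _ 3) => // e e0.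
have [p Fp] := aF _ e0.
have -> : circle_integral (fun t => F (expi t)) - F 0 =
    circle_integral (fun t => F (expi t) - p.[expi t]) - (F 0 - p.[0]).
  rewrite circle_integralB ?circle_integral_horner; [by ring|..].
    exact: ccont_integrable.
  by apply: ccont_integrable; exact: ccont_horner.
apply: le_trans (ler_normcD _ _) _; rewrite normc_opp.
have -> : 3 * e = 2 * e + e by ring.
apply: lerD; last by apply: Fp; rewrite normc0.
apply: circle_integral_bound => [|t _]; last by apply: Fp; rewrite normc_expi.
by apply: cintegrableB; apply: ccont_integrable => //; exact: ccont_horner.
Qed.

(** * The Herglotz formula and the maximum principle *)

(** The Herglotz kernel, whose real part is the Poisson kernel. *)
Definition herglotz (R : realType) (z : R[i]) (t : R) : R[i] :=
  (expi t + z) / (expi t - z).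

Lemma ccont_herglotz (R : realType) (z : R[i]) : normc z < 1 -> ccont (herglotz z).
Proof.
move=> z1; apply: ccontM.
  by apply: ccontD; [exact: ccont_expi|exact: ccont_cst].
apply: ccontV => [|t]; last exact: expi_sub_neq0.
by apply: (@ccontD _ _ (fun=> - z)); [exact: ccont_expi|exact: ccont_cst].
Qed.

Lemma herglotz_bound (R : realType) (z : R[i]) (t : R) : normc z < 1 ->
  normc (herglotz z t) <= 2 / (1 - normc z).
Proof.
move=> z1; rewrite normcM normcV; apply: ler_pM.
- exact: normc_ge0.
- by rewrite invr_ge0 normc_ge0.
- by apply: le_trans (ler_normcD _ _) _; rewrite normc_expi -[2]/(1 + 1) lerD2l ltW.
have d0 : 0 < 1 - normc z by rewrite subr_gt0.
rewrite lef_pV2 ?posrE ?normc_gt0 ?expi_sub_neq0//.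
by rewrite lerBlDr -{1}(normc_expi t) -{1}(subrK z (expi t)) ler_normcD.
Qed.

(** The real part is [(1 - |z|^2) / |w - z|^2] at the point [w] of the circle. *)
Lemma Re_herglotz_ge0 (R : realType) (z : R[i]) (t : R) : normc z < 1 ->
  0 <= Re (herglotz z t).
Proof.
move=> z1; rewrite /herglotz invcE mulrCA cReM/= mul0r subr0.
apply: mulr_ge0; first by rewrite invr_ge0 sqr_ge0.
have : normc z ^+ 2 <= 1 by rewrite expr_le1 ?normc_ge0// ltW.
rewrite sqr_normcE; case: z {z1} => x y /= z1.
have -> : (cos t + x) * (cos t - x) - (sin t + y) * - (sin t - y) =
  (cos t ^+ 2 + sin t ^+ 2) - (x ^+ 2 + y ^+ 2) by ring.
by rewrite cos2Dsin2 subr_ge0.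
Qed.

Lemma herglotz_integrable (R : realType) (z : R[i]) (u : R -> R) : normc z < 1 ->
  circle_integrable u -> cintegrable (fun t => herglotz z t * (u t)%:C).
Proof. by move=> z1 ui; apply: ccont_integrableM => //; exact: ccont_herglotz. Qed.

(** For [w] on the circle, the conjugate of the kernel is [(1 + z' w) / (1 - z' w)]
    with [z'] the conjugate of [z]. This is an element of the disc algebra as a
    function of [w], so the mean value property applies to the conjugate of the
    integrand. *)
Lemma circle_integral_herglotzJ (R : realType) (F : R[i] -> R[i]) (z : R[i]) :
  normc z < 1 -> disc_algebra F ->
  circle_integral (fun t => herglotz z t * (F (expi t))^*) = (F 0)^*.
Proof.
move=> z1 dF; have zJ1 : normc z^* < 1 by rewrite normc_conj.
pose G x := (1 + z^* * x) * (1 - z^* * x)^-1 * F x.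
have dG : disc_algebra G.
  apply: disc_algebraM => //; apply: disc_algebraM; last exact: disc_algebra_geom.
  apply: disc_algebraD; first exact: disc_algebra_cst.
  by apply: disc_algebraM; [exact: disc_algebra_cst|exact: disc_algebra_id].
have -> : (F 0)^* = (G 0)^* by rewrite /G !mulr0 subr0 addr0 invr1 !mul1r.
rewrite -(circle_integral_disc_algebra dG) -circle_integralJ; last first.
  by apply: ccont_integrable; case: dG.
apply: eq_circle_integral => t _; rewrite /G rmorphM/=; congr (_ * _).
rewrite rmorphM fmorphV rmorphB rmorphD !rmorphM rmorph1/= conjCK expiJ.
have w0 := expi_neq0 t; have wz := expi_sub_neq0 t z1.
rewrite /herglotz; field.
by rewrite w0 wz.
Qed.

Lemma circle_integral_herglotz (R : realType) (z : R[i]) : normc z < 1 ->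
  circle_integral (herglotz z) = 1.
Proof.
move=> z1; have := circle_integral_herglotzJ z1 (disc_algebra_cst 1).
rewrite conjC1 => <-; apply: eq_circle_integral => t _.
by rewrite mulr1.
Qed.

(** Write [p = p(z) + (X - z) q]: the factor [w - z] cancels the pole of the kernel,
    and what is left is the mean of the polynomial [(X + z) q]. *)
Lemma circle_integral_herglotz_horner (R : realType) (p : {poly R[i]}) (z : R[i]) :
  normc z < 1 ->
  circle_integral (fun t => herglotz z t * p.[expi t]) = 2 * p.[z] - p.[0].
Proof.
move=> z1.
have /factor_theorem [q pq] : root (p - (p.[z])%:P) z.
  by rewrite /root hornerD hornerN hornerC subrr.
have pE x : p.[x] = p.[z] + q.[x] * (x - z).
  by rewrite -[p in LHS](subrK p.[z]%:P) pq hornerD hornerM hornerXsubC hornerC addrC.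
have -> : circle_integral (fun t => herglotz z t * p.[expi t]) =
    circle_integral (fun t => p.[z] * herglotz z t + (('X + z%:P) * q).[expi t]).
  apply: eq_circle_integral => t _.
  rewrite [in LHS]pE hornerM hornerD hornerX hornerC /herglotz.
  by have wz := expi_sub_neq0 t z1; field.
have Ki := ccont_integrable (ccont_herglotz z1).
rewrite circle_integralD ?circle_integralZ//; last 2 first.
- exact: cintegrableZ.
- by apply: ccont_integrable; exact: ccont_horner.
rewrite circle_integral_herglotz// circle_integral_horner (pE 0).
by rewrite hornerM hornerD hornerX hornerC; ring.
Qed.

Lemma circle_integral_herglotzM (R : realType) (F : R[i] -> R[i]) (z : R[i]) :
  normc z < 1 -> disc_algebra F ->
  circle_integral (fun t => herglotz z t * F (expi t)) = 2 * F z - F 0.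
Proof.
move=> z1 [cF aF]; apply/eqP; rewrite -subr_eq0; apply/eqP.
have d0 : 0 < 1 - normc z by rewrite subr_gt0.
pose B : R := 2 / (1 - normc z).
have B0 : 0 <= B by rewrite divr_ge0// ltW.
apply: (@normc_le_eps _ _ (2 * B + 3)); first by rewrite addr_ge0// mulr_ge0.
move=> e e0; have [p Fp] := aF _ e0.
have cK := ccont_herglotz z1; have cp := ccont_horner p.
have -> : circle_integral (fun t => herglotz z t * F (expi t)) - (2 * F z - F 0) =
    circle_integral (fun t => herglotz z t * (F (expi t) - p.[expi t]))
    - (2 * (F z - p.[z]) - (F 0 - p.[0])).
  have -> : (fun t => herglotz z t * (F (expi t) - p.[expi t])) =
      (fun t => herglotz z t * F (expi t) - herglotz z t * p.[expi t]).
    by apply/funext => t; rewrite mulrBr.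
  rewrite circle_integralB ?circle_integral_herglotz_horner//.
  - by ring.
  - by apply: ccont_integrable; exact: ccontM.
  - by apply: ccont_integrable; exact: ccontM.
have -> : (2 * B + 3) * e = 2 * (B * e) + (2 * e + e) by ring.
apply: le_trans (ler_normcD _ _) _; apply: lerD.
  apply: circle_integral_bound => [|t _].
    apply: ccont_integrable; apply: ccontM => //.
    by apply: (@ccontD _ _ (fun t => - p.[expi t])) => //;
      under eq_fun do rewrite -hornerN; exact: ccont_horner.
  rewrite normcM; apply: ler_pM; rewrite ?normc_ge0 ?herglotz_bound//.
  by apply: Fp; rewrite normc_expi.
rewrite normc_opp; apply: le_trans (ler_normcD _ _) _; rewrite normc_opp normcM.
apply: lerD; last by apply: Fp; rewrite normc0.
have -> : normc (2 : R[i]) = 2.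
  by rewrite (_ : 2 = 2%:C) ?normc_realE ?ger0_norm// rmorph_nat.
by rewrite ler_pM2l//; apply: Fp; exact: ltW.
Qed.

(** Half the sum of the formulas for [F] and for its conjugate: an element of the disc
    algebra is determined by its real part on the circle, up to an imaginary
    constant. *)
Lemma herglotz_representation (R : realType) (F : R[i] -> R[i]) (z : R[i]) :
  normc z < 1 -> disc_algebra F ->
  circle_integral (fun t => herglotz z t * (Re (F (expi t)))%:C) =
  F z - (0 +i* Im (F 0)).
Proof.
move=> z1 dF; have [cF _] := dF; have cK := ccont_herglotz z1.
have -> : circle_integral (fun t => herglotz z t * (Re (F (expi t)))%:C) =
    circle_integral (fun t => 2^-1 * (herglotz z t * F (expi t) +
                                      herglotz z t * (F (expi t))^*)).
  by apply: eq_circle_integral => t _; rewrite ReJ_add; field.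
rewrite circle_integralZ ?circle_integralD//; last first.
- by apply: ccont_integrable; apply: ccontD; apply: ccontM => //; exact: ccontJ.
- by apply: ccont_integrable; apply: ccontM => //; exact: ccontJ.
- by apply: ccont_integrable; exact: ccontM.
rewrite circle_integral_herglotzM// circle_integral_herglotzJ//.
have -> : 0 +i* Im (F 0) = (F 0 - (F 0)^*) * (2^-1)%:C.
  by case: (F 0) => a b; apply: complex_ext; rewrite ?cReM ?cImM/=; field.
rewrite fmorphV rmorph_nat.
by field.
Qed.

(** The Poisson kernel is nonnegative and has mean 1, so [Re (F z)] is an average of
    the values of [Re F] on the circle. *)
Lemma disc_algebra_max_Re (R : realType) (F : R[i] -> R[i]) (S : R) (z : R[i]) :
  normc z < 1 -> disc_algebra F ->
  (forall t, Re (F (expi t)) <= S) -> Re (F z) <= S.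
Proof.
move=> z1 dF FS; have [[cF _] _] := dF; have [cK _] := ccont_herglotz z1.
have -> : Re (F z) = circle_mean (fun t => Re (herglotz z t) * Re (F (expi t))).
  have /(congr1 Re) := herglotz_representation z1 dF.
  rewrite circle_integralE/= cReD cReN/= oppr0 addr0 => <-.
  by congr circle_mean; apply/funext => t; rewrite cReM mulr0 subr0.
have -> : S = circle_mean (fun t => S * Re (herglotz z t)).
  rewrite circle_meanZ; last exact: continuous_circle_integrable.
  have /(congr1 Re) := circle_integral_herglotz z1; rewrite circle_integralE /=.
  by move=> ->; rewrite mulr1.
apply: le_circle_mean.
- by apply: circle_integrableM => //; exact: continuous_circle_integrable.
- by apply: circle_integrableZ; exact: continuous_circle_integrable.
- by move=> t _; rewrite mulrC ler_wpM2r// Re_herglotz_ge0.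
Qed.

(** * Polynomial approximation of the logarithm *)

(** Derivative of a complex-valued function of a real variable, by components, so that
    the mean value theorem applies to each of them. *)
Definition is_cderive (R : realType) (G : R -> R[i]) (s : R) (d : R[i]) :=
  is_derive s (1:R) (fun s => Re (G s)) (Re d) /\
  is_derive s (1:R) (fun s => Im (G s)) (Im d).

Lemma is_cderiveM (R : realType) (F G : R -> R[i]) (s : R) (f g : R[i]) :
  is_cderive F s f -> is_cderive G s g ->
  is_cderive (fun s => F s * G s) s (f * G s + F s * g).
Proof.
move=> [f1 f2] [g1 g2]; split.
  under eq_fun do rewrite cReM.
  by apply: is_derive_eq; rewrite /GRing.scale/= cReD !cReM; ring.
under eq_fun do rewrite cImM.
by apply: is_derive_eq; rewrite /GRing.scale/= cImD !cImM; ring.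
Qed.

Lemma is_cderive_horner (R : realType) (q : {poly R[i]}) (s : R) :
  is_cderive (fun s => q.[s%:C]) s q^`().[s%:C].
Proof.
elim/poly_ind: q => [|q c [IH1 IH2]].
  by split; under eq_fun do rewrite horner0; rewrite deriv0 horner0; exact: is_derive_cst.
rewrite derivMXaddC hornerD hornerMX; split.
  under eq_fun do rewrite hornerMXaddC cReD cReM/= mulr0 subr0.
  by apply: is_derive_eq; rewrite /GRing.scale/= !cReD cReM/=; ring.
under eq_fun do rewrite hornerMXaddC cImD cImM/= mulr0 add0r.
by apply: is_derive_eq; rewrite /GRing.scale/= !cImD cImM/=; ring.
Qed.

Lemma is_cderive_cexp (R : realType) (F : R -> R[i]) (s : R) (f : R[i]) :
  is_cderive F s f -> is_cderive (fun s => cexp (F s)) s (f * cexp (F s)).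
Proof.
move=> [f1 f2]; rewrite /cexp /expi; split.
  under eq_fun do rewrite cReM/= mul0r subr0.
  by apply: is_derive_eq; rewrite /GRing.scale/= !(cReM, cImM)/=; ring.
under eq_fun do rewrite cImM/= mul0r addr0.
by apply: is_derive_eq; rewrite /GRing.scale/= !(cImM, cReM)/=; ring.
Qed.

(** As the mean value theorem is used once for each component, the two intermediate
    points differ and the bound doubles. *)
Lemma cderive_bound (R : realType) (G dG : R -> R[i]) (M : R) :
  (forall s, is_cderive G s (dG s)) ->
  (forall s, 0 <= s <= 1 -> normc (dG s) <= M) ->
  normc (G 1 - G 0) <= 2 * M.
Proof.
move=> der bd.
have mvt (f df : R -> R) : (forall s, is_derive s (1:R) f (df s)) ->
    (forall s, 0 <= s <= 1 -> `|df s| <= M) -> `|f 1 - f 0| <= M.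
  move=> df' fM; have cf : {within `[0, 1], continuous f}.
    apply: continuous_subspaceT => t.
    by apply: differentiable_continuous; apply/derivable1_diffP; have [] := df' t.
  have [c c01 ->] := MVT ltr01 (fun c _ => df' c) cf.
  by move: c01; rewrite in_itv/= subr0 mulr1 => /andP[c0 c1]; rewrite fM// !ltW.
have -> : 2 * M = M + M by ring.
apply: le_trans (normc_le_ReIm _) _; rewrite cReD cImD cReN cImN; apply: lerD.
  apply: (mvt (fun s => Re (G s)) (fun s => Re (dG s))) => s; first by have [] := der s.
  by move=> /bd; apply: le_trans; exact: Re_le_normc.
apply: (mvt (fun s => Im (G s)) (fun s => Im (dG s))) => s; first by have [] := der s.
by move=> /bd; apply: le_trans; exact: Im_le_normc.
Qed.

(** Taylor polynomial of [log (1 - x)] at 0. *)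
Definition log_poly (R : realType) (N : nat) : {poly R[i]} :=
  - \sum_(i < N) (i.+1)%:R^-1 *: 'X^(i.+1).

Lemma log_poly0 (R : realType) N : (log_poly R N).[0] = 0.
Proof.
rewrite hornerN horner_sum big1 ?oppr0// => i _.
by rewrite hornerZ hornerXn expr0n mulr0.
Qed.

Lemma deriv_log_poly (R : realType) N : (log_poly R N)^`() * (1 - 'X) = 'X^N - 1.
Proof.
rewrite derivN raddf_sum (eq_bigr (fun i : 'I_N => 'X^i)); last first.
  move=> i _ /=; rewrite derivZ derivXn/= -scalerMnr scalerMnl -mulr_natr.
  by rewrite mulVf ?scale1r//.
rewrite -[RHS]opprB -[X in _ = - (X - _)](expr1n _ N) subrXX mulNr mulrC.
by congr (- (_ * _)); apply: eq_bigr => i _; rewrite expr1n mul1r.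
Qed.

Lemma log_poly_bound (R : realType) N (rho : R) (x : R[i]) : rho < 1 ->
  normc x <= rho -> normc (log_poly R N).[x] <= (1 - rho)^-1.
Proof.
move=> r1 xr; have r0 : 0 <= rho := le_trans (normc_ge0 _) xr.
have d0 : 0 < 1 - rho by rewrite subr_gt0.
rewrite hornerN horner_sum normc_opp.
apply: (@le_trans _ _ (\sum_(i < N) rho ^+ i)).
  elim/big_ind2: _ => [|y b z c yb zc|i _]; first by rewrite normc0.
    by apply: le_trans (ler_normcD _ _) _; exact: lerD.
  rewrite hornerZ hornerXn normcM normcX normcV.
  have -> : normc (i.+1%:R : R[i]) = i.+1%:R.
    by rewrite -[i.+1%:R](rmorph_nat (real_complex R)) normc_realE ger0_norm.
  apply: (@le_trans _ _ (1 * rho ^+ i.+1)).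
    apply: ler_pM; rewrite ?invr_ge0 ?exprn_ge0 ?normc_ge0//.
      by rewrite invf_le1// ler1n.
    by apply: lerXn2r; rewrite ?nnegrE ?normc_ge0.
  by rewrite mul1r exprS ler_piMl ?exprn_ge0// ltW.
rewrite -[leRHS]mul1r ler_pdivlMr// mulrC.
have := subrXX 1 rho N; rewrite expr1n (eq_bigr (fun i : 'I_N => rho ^+ i)).
  by move=> <-; rewrite lerBlDr lerDl exprn_ge0.
by move=> i _; rewrite expr1n mul1r.
Qed.

(** Along the segment from 0 to [x], the function [G s = exp (- p (s x)) (1 - s x)]
    starts at 1, and its derivative [- x (s x)^N exp (- p (s x))] is small because
    [p' (1 - X) = X^N - 1]. *)
Lemma cexp_log_poly_error (R : realType) N (rho : R) (x : R[i]) : rho < 1 ->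
  normc x <= rho ->
  normc (cexp (- (log_poly R N).[x]) * (1 - x) - 1) <= 2 * (expR (1 - rho)^-1 * rho ^+ N).
Proof.
move=> r1 xr; have r0 : 0 <= rho := le_trans (normc_ge0 _) xr.
pose q : {poly R[i]} := - (log_poly R N \Po (x *: 'X)).
pose r : {poly R[i]} := 1 - x *: 'X.
pose G s := cexp q.[s%:C] * r.[s%:C].
have qE s : q.[s%:C] = - (log_poly R N).[x * s%:C].
  by rewrite hornerN horner_comp hornerZ hornerX.
have rE y : r.[y] = 1 - x * y.
  by rewrite /r hornerD hornerN hornerC hornerZ hornerX.
have -> : cexp (- (log_poly R N).[x]) * (1 - x) - 1 = G 1 - G 0.
  by rewrite /G !qE !rE mulr1 mulr0 subr0 mulr1 log_poly0 oppr0 cexp0.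
pose dG s := (q^`().[s%:C] * cexp q.[s%:C]) * r.[s%:C] + cexp q.[s%:C] * r^`().[s%:C].
apply: (@cderive_bound _ _ dG).
  move=> s; apply: (is_cderiveM (G := fun s => r.[s%:C])); last exact: is_cderive_horner.
  by apply: is_cderive_cexp; exact: is_cderive_horner.
move=> s /andP[s0 s1].
have sx : normc (x * s%:C) <= rho.
  by rewrite normcM normc_realE ger0_norm// (le_trans _ xr)// ler_piMr// normc_ge0.
have -> : dG s = cexp q.[s%:C] * (- x * (x * s%:C) ^+ N).
  rewrite /dG; have -> : r^`().[s%:C] = - x.
    rewrite derivB derivC derivZ derivX hornerD hornerN hornerC hornerZ hornerC.
    by rewrite mulr1 sub0r.
  have : q^`().[s%:C] * r.[s%:C] = x * (1 - (x * s%:C) ^+ N).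
    rewrite derivN deriv_comp derivZ derivX alg_polyC hornerN hornerM hornerC.
    rewrite horner_comp hornerZ hornerX.
    have /(congr1 (fun p => p.[x * s%:C])) := deriv_log_poly R N.
    rewrite hornerM [in RHS]hornerD hornerXn hornerN hornerC.
    rewrite hornerD hornerC hornerN hornerX rE => H.
    have -> : 1 - (x * s%:C) ^+ N = - ((x * s%:C) ^+ N - 1) by ring.
    by rewrite -H; ring.
  by move=> H; rewrite mulrAC H; ring.
rewrite normcM normc_cexp; apply: ler_pM; rewrite ?expR_ge0 ?normc_ge0//.
  rewrite ler_expR qE cReN; apply: le_trans (log_poly_bound N r1 sx).
  by apply: le_trans (Re_le_normc _); rewrite -normrN ler_norm.
rewrite normcM normc_opp normcX; apply: (@le_trans _ _ (1 * rho ^+ N)).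
  apply: ler_pM; rewrite ?normc_ge0 ?exprn_ge0 ?normc_ge0//.
    by rewrite (le_trans xr)// ltW.
  by apply: lerXn2r; rewrite ?nnegrE ?normc_ge0.
by rewrite mul1r.
Qed.

Lemma abs_ln_le (R : realType) (y d : R) : d <= 2^-1 -> `|y - 1| <= d -> `|ln y| <= 2 * d.
Proof.
move=> d2; rewrite ler_distl => /andP[y1 y2]; have y0 : 2^-1 <= y by lra.
have yp : 0 < y by lra.
rewrite ler_norml; apply/andP; split.
  rewrite lerNl -lnV ?posrE//.
  have h := @le_ln1Dx R (y^-1 - 1).
  rewrite (_ : 1 + (y^-1 - 1) = y^-1) in h; last by ring.
  apply: le_trans (h _) _.
    have yV : 0 < y^-1 by rewrite invr_gt0.
    lra.
  by rewrite lerBlDr -div1r ler_pdivrMr//; nra.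
have h := @le_ln1Dx R (y - 1).
rewrite (_ : 1 + (y - 1) = y) in h; last by ring.
by apply: le_trans (h _) _; lra.
Qed.

(** The polynomial stands for a logarithm of [1 - x] without a choice of branch: its
    exponential is close to [1 - x], and its real part to [ln |1 - x|]. *)
Lemma exp_log_approx (R : realType) (rho e : R) : 0 <= rho < 1 -> 0 < e ->
  exists p : {poly R[i]}, p.[0] = 0 /\
  forall x, normc x <= rho ->
    normc (cexp p.[x] - (1 - x)) <= e /\ `|ln (normc (1 - x)) - Re p.[x]| <= e.
Proof.
move=> r01 e0; have /andP[r0 r1] := r01.
pose B : R := expR (1 - rho)^-1.
have B1 : 1 <= B.
  by rewrite -expR0 ler_expR invr_ge0 subr_ge0 ltW.
(* [d <= 1/2] is what [abs_ln_le] requires; [2 B d <= e] covers the factor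
   [|exp p| <= B] in the first estimate and the factor 2 in the second one *)
pose d := Num.min (2^-1) (e / (2 * B)).
have B0 : 0 < B := lt_le_trans ltr01 B1.
have d0 : 0 < d by rewrite lt_min invr_gt0 ltr0n divr_gt0// mulr_gt0.
have dB : 2 * B * d <= e.
  by rewrite -ler_pdivlMl ?mulr_gt0// mulrC ge_min lexx orbT.
have [N HN] := exists_expr_le r01 (divr_gt0 d0 (mulr_gt0 (ltr0Sn R 1) B0)).
exists (log_poly R N); split; first exact: log_poly0.
move=> x xr; have := cexp_log_poly_error N r1 xr.
set p := (log_poly R N).[x]; set g := cexp (- p) * (1 - x) => gd.
have {gd} gd : normc (g - 1) <= d.
  apply: le_trans gd _; rewrite mulrA mulrC -ler_pdivlMr// ?mulr_gt0//.
have gE : 1 - x = cexp p * g by rewrite mulrA [cexp p * _]mulrC cexpN mul1r.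
split.
  have -> : cexp p - (1 - x) = cexp p * (1 - g) by rewrite gE; ring.
  rewrite normcM normc_cexp normc_distC; apply: le_trans dB.
  apply: (@le_trans _ _ (B * d)); last by have := mulr_gt0 B0 d0; nra.
  apply: ler_pM; rewrite ?expR_ge0 ?normc_ge0// ler_expR.
  apply: le_trans (ler_norm _) (le_trans (Re_le_normc _) _).
  exact: log_poly_bound.
have nx : 0 < normc (1 - x) by rewrite normc_gt0 one_sub_neq0// (le_lt_trans xr).
have -> : ln (normc (1 - x)) - Re p = ln (normc g).
  have ng : 0 < normc g.
    rewrite normc_gt0; apply/eqP => g0; move: nx; rewrite gE g0 mulr0 normc0.
    by rewrite ltxx.
  by rewrite gE normcM normc_cexp lnM ?posrE ?expR_gt0// expRK addrC addKr.
apply: (@le_trans _ _ (2 * d)).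
  apply: abs_ln_le; first by rewrite ge_min lexx.
  have h1 : normc g <= normc (g - 1) + 1.
    by rewrite -[X in _ + X](@normc1 R); apply: le_trans (ler_normcD _ _); rewrite subrK.
  have h2 : 1 <= normc (1 - g) + normc g.
    by rewrite -[X in X <= _](@normc1 R); apply: le_trans (ler_normcD _ _); rewrite subrK.
  rewrite normc_distC in h2; rewrite ler_distl; lra.
by apply: le_trans dB; nra.
Qed.

(** * Limits of means *)

(** Convergence by components, in order to reuse the real limits of means, of [expR]
    and of the trigonometric functions. *)
Definition ccvg (R : realType) (u : nat -> R[i]) (l : R[i]) :=
  (fun n => Re (u n)) @ \oo --> Re l /\ (fun n => Im (u n)) @ \oo --> Im l.

Lemma ccvg_unique (R : realType) (u : nat -> R[i]) (l l' : R[i]) :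
  ccvg u l -> ccvg u l' -> l = l'.
Proof.
move=> [r1 i1] [r2 i2]; apply: complex_ext.
  exact: (cvg_unique _ r1 r2).
exact: (cvg_unique _ i1 i2).
Qed.

Lemma ccvg_dist (R : realType) (u : nat -> R[i]) (l : R[i]) (e : nat -> R) :
  e @ \oo --> 0 -> (forall n, normc (u n - l) <= e n) -> ccvg u l.
Proof.
have sq (v : nat -> R) a : e @ \oo --> 0 -> (forall n, `|v n - a| <= e n) ->
    v @ \oo --> a.
  move=> /cvgrPdist_le e0 ve; apply/cvgrPdist_le => d d0.
  have [N _ H] := e0 d d0; exists N => // n /H /=; rewrite sub0r normrN => h.
  by rewrite distrC; apply: le_trans (ve n) (le_trans (ler_norm _) h).
move=> e0 ue; split; apply: sq e0 _ => n; apply: le_trans (ue n).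
  by rewrite -cReN -cReD Re_le_normc.
by rewrite -cImN -cImD Im_le_normc.
Qed.

Lemma ccvg_cexp (R : realType) (u : nat -> R[i]) (l : R[i]) :
  ccvg u l -> ccvg (fun n => cexp (u n)) (cexp l).
Proof.
move=> [r i]; rewrite /cexp /expi.
have er : (fun n => expR (Re (u n))) @ \oo --> expR (Re l).
  by apply: continuous_cvg r; exact: continuous_expR.
have ci : (fun n => cos (Im (u n))) @ \oo --> cos (Im l).
  by apply: continuous_cvg i; exact: continuous_cos.
have si : (fun n => sin (Im (u n))) @ \oo --> sin (Im l).
  by apply: continuous_cvg i; exact: continuous_sin.
split.
  rewrite /= mul0r subr0; under eq_fun do rewrite mul0r subr0.
  exact: cvgM er ci.
rewrite /= mul0r addr0; under eq_fun do rewrite mul0r addr0.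
exact: cvgM er si.
Qed.

(** Nonnegative functions with a constant mean, converging outside of a null set, have
    an integrable limit: by Fatou's lemma the integral of the limit is at most
    [2 pi M]. *)
Lemma fatou_circle_integrable (R : realType) (f_ : nat -> R -> R) (f : R -> R)
    (N : set (measurableTypeR R)) (M : R) :
  measurable N -> lebesgue_measure N = 0 -> measurable_fun (period R) f ->
  (forall n, circle_integrable (f_ n)) ->
  (forall n t, t \in `[0, 2 * pi] -> 0 <= f_ n t) ->
  (forall n, circle_mean (f_ n) = M) ->
  (forall t, t \in `[0, 2 * pi] -> ~ N t -> f_ ^~ t @ \oo --> f t) ->
  circle_integrable f.
Proof.
move=> mN N0 mf fi f0 fM fcvg.
have mI := @measurable_period R.
have mD : measurable (period R `\` N : set (measurableTypeR R)) by exact: measurableD.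
apply/(negligible_integrable mN mI _ N0).
  by apply/measurable_EFinP.
apply/integrableP; split.
  apply/measurable_EFinP; apply: measurable_funS mf => //; exact: subDsetl.
have meas n : measurable_fun (period R `\` N) (EFin \o f_ n).
  apply: measurable_funS (measurable_int _ (fi n)) => //; exact: subDsetl.
have f0' n t : (period R `\` N) t -> (0 <= (EFin \o f_ n) t)%E.
  by move=> [It _]; rewrite lee_fin f0.
have := fatou lebesgue_measure mD meas f0'.
have -> : (fun n => \int[lebesgue_measure]_(t in period R `\` N) (EFin \o f_ n) t)%E
    = cst ((2 * pi) * M)%:E.
  apply/funext => n; rewrite -(negligible_integral mN mI (fi n) N0).
  rewrite -[LHS]fineK; last exact: (integrable_fin_num mI (fi n)).
  congr EFin; rewrite -(fM n) /circle_mean mulVKf//.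
  by rewrite gt_eqF// mulr_gt0// pi_gt0.
rewrite (cvg_limn_einf_sup (cvg_cst _)) => h.
apply: le_lt_trans (ltry (2 * pi * M)).
apply: le_trans h.
rewrite le_eqVlt; apply/orP; left; apply/eqP; apply: eq_integral => t.
rewrite inE => -[It Nt]; have ft := fcvg t It Nt.
have -> : limn_einf ((fun n => EFin \o f_ n)^~ t) = (f t)%:E.
  have ft' : (fun n => (EFin \o f_ n) t) @ \oo --> (f t)%:E.
    by apply: cvg_EFin ft; near=> n.
  by rewrite (cvg_limn_einf_sup ft').
rewrite /= ger0_norm//; rewrite -(cvg_lim _ ft)//.
apply: limr_ge; first by apply: cvgP ft.
by apply: nearW => n; exact: f0.
Unshelve. all: by end_near. Qed.

Lemma dominated_circle_mean (R : realType) (f_ : nat -> R -> R) (f g : R -> R)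
    (N : set (measurableTypeR R)) :
  measurable N -> lebesgue_measure N = 0 ->
  (forall n, measurable_fun (period R) (f_ n)) -> measurable_fun (period R) f ->
  circle_integrable g ->
  (forall n t, t \in `[0, 2 * pi] -> ~ N t -> `|f_ n t| <= g t) ->
  (forall t, t \in `[0, 2 * pi] -> ~ N t -> f_ ^~ t @ \oo --> f t) ->
  (fun n => circle_mean (f_ n)) @ \oo --> circle_mean f.
Proof.
move=> mN N0 mf_ mf gi fg fcvg; have mI := @measurable_period R.
have nN : lebesgue_measure.-negligible N by apply/negligibleP.
have mE n : measurable_fun (period R) (EFin \o f_ n) by apply/measurable_EFinP.
have mE' : measurable_fun (period R) (EFin \o f) by apply/measurable_EFinP.
have cv : {ae lebesgue_measure, forall t, period R t ->
    (fun n => (EFin \o f_ n) t) @ \oo --> (EFin \o f) t}.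
  apply: negligibleS nN => t /= /not_implyP[It nc]; apply: contrapT => Nt.
  apply: nc; apply: cvg_EFin (fcvg t It Nt); by near=> n.
have dom : {ae lebesgue_measure, forall t n, period R t ->
    (`|(EFin \o f_ n) t| <= (EFin \o g) t)%E}.
  apply: negligibleS nN => t /= /existsNP[n /not_implyP[It nc]].
  by apply: contrapT => Nt; apply: nc; rewrite lee_fin; exact: fg.
have [fi _ H] := dominated_convergence mI mE mE' cv gi dom.
rewrite /circle_mean; apply: cvgMl_tmp.
apply: fine_cvg.
rewrite -(fineK (integrable_fin_num mI fi)) in H.
exact: H.
Unshelve. all: by end_near. Qed.

(** * Logarithmic potentials *)

Definition log_dist (R : realType) (a : R[i]) (t : R) : R := ln (normc (1 - a * expi t)).

Lemma continuous_normc (R : realType) (F : R -> R[i]) : ccont F ->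
  continuous (fun t => normc (F t)).
Proof.
move=> [c1 c2] t.
have -> : (fun t => normc (F t)) =
    (fun t => Num.sqrt (Re (F t) * Re (F t) + Im (F t) * Im (F t))).
  by apply/funext => s; rewrite -!expr2 -sqr_normcE sqrtr_sqr ger0_norm ?normc_ge0.
apply: (@continuous_comp _ _ _ (fun t => Re (F t) * Re (F t) + Im (F t) * Im (F t))
  (fun x => Num.sqrt x)); last exact: sqrt_continuous.
exact: continuousD (continuousM (c1 t) (c1 t)) (continuousM (c2 t) (c2 t)).
Qed.

Lemma ccont_one_sub (R : realType) (a : R[i]) : ccont (fun t => 1 - a * expi t).
Proof.
apply: (@ccontD _ (fun=> 1) (fun t => - (a * expi t))); first exact: ccont_cst.
under eq_fun do rewrite -mulNr.
by apply: ccontM; [exact: ccont_cst|exact: ccont_expi].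
Qed.

Lemma continuous_log_dist (R : realType) (a : R[i]) : normc a < 1 ->
  continuous (log_dist a).
Proof.
move=> a1 t; apply: (@continuous_comp _ _ _ (fun t => normc (1 - a * expi t)) (@ln R)).
  by apply: continuous_normc; exact: ccont_one_sub.
apply: continuous_ln; rewrite normc_gt0; apply: one_sub_neq0.
by apply: normcM_lt1 => //; rewrite normc_expi.
Qed.

Lemma measurable_log_dist (R : realType) (a : R[i]) :
  measurable_fun (period R) (log_dist a).
Proof.
apply: (@measurableT_comp _ _ _ _ _ _ (@ln R) _ (fun t => normc (1 - a * expi t))).
  exact: measurable_ln.
apply: continuous_measurable_period; apply: continuous_normc.
exact: ccont_one_sub.
Qed.

(** For [|a| <= 1] and [|z| < 1] this is a logarithm of [1 - a z], recovered from the
    logarithm of the modulus on the circle. *)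
Definition log_potential (R : realType) (a z : R[i]) : R[i] :=
  circle_integral (fun t => herglotz z t * (log_dist a t)%:C).

(** The Herglotz formula computes the mean of the kernel against [Re p], for the
    polynomials [p] that approximate the logarithm of [1 - a x]; it is [p (a z)]. Both
    sides of the formula converge. *)
Lemma exp_log_potential_lt1 (R : realType) (a z : R[i]) :
  normc a < 1 -> normc z < 1 -> cexp (log_potential a z) = 1 - a * z.
Proof.
move=> a1 z1.
have a01 : 0 <= normc a < 1 by rewrite normc_ge0.
have [p Hp] := choice (fun n => exp_log_approx a01 (harmonic_gt0 n)).
have axa (x : R[i]) : normc x <= 1 -> normc (a * x) <= normc a.
  by move=> x1; rewrite normcM ler_piMr// normc_ge0.
have d0 : 0 < 1 - normc z by rewrite subr_gt0.
pose B : R := 2 / (1 - normc z).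
have B0 : 0 <= B by rewrite divr_ge0// ltW.
have cK := ccont_herglotz z1.
have repr n : circle_integral (fun t => herglotz z t * (Re (p n).[a * expi t])%:C)
    = (p n).[a * z].
  have dF : disc_algebra (fun x => (p n).[a * x]).
    have := disc_algebra_horner ((p n) \Po (a *: 'X)); congr disc_algebra.
    by apply/funext => x; rewrite horner_comp hornerZ hornerX.
  by rewrite (herglotz_representation z1 dF)/= mulr0 (Hp n).1 subr0.
have cp n : ccont (fun t => (Re (p n).[a * expi t])%:C).
  apply: ccontR; have := (ccont_horner ((p n) \Po (a *: 'X))).1.
  by under eq_fun do rewrite horner_comp hornerZ hornerX.
have cL : ccont (fun t => (log_dist a t)%:C) by apply: ccontR; exact: continuous_log_dist.
have cvL : ccvg (fun n => (p n).[a * z]) (log_potential a z).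
  apply: (@ccvg_dist _ _ _ (fun n => 2 * B * harmonic n)).
    by rewrite -[X in _ --> X](mulr0 (2 * B)); apply: cvgMl_tmp; exact: cvg_harmonic.
  move=> n; rewrite -repr /log_potential -circle_integralB; last 2 first.
  - by apply: ccont_integrable; apply: ccontM.
  - by apply: ccont_integrable; apply: ccontM.
  rewrite -mulrA; apply: circle_integral_bound.
    by apply: cintegrableB; apply: ccont_integrable; apply: ccontM.
  move=> t _; rewrite -mulrBr normcM; apply: ler_pM; rewrite ?normc_ge0//.
    exact: herglotz_bound.
  rewrite -rmorphB normc_realE distrC.
  exact: ((Hp n).2 _ (axa _ (normc_expi_le1 _))).2.
apply: ccvg_unique (ccvg_cexp cvL) _.
apply: (@ccvg_dist _ _ _ harmonic); first exact: cvg_harmonic.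
by move=> n; have [_ /(_ _ (axa _ (ltW z1)))[]] := Hp n.
Qed.

(** The case [z = 0], where the kernel is 1 and the potential is real: Jensen's
    formula for a function without zeros in the disc. *)
Lemma circle_mean_log_dist (R : realType) (a : R[i]) : normc a < 1 ->
  circle_mean (log_dist a) = 0.
Proof.
move=> a1; have z1 : normc (0 : R[i]) < 1 by rewrite normc0.
have := exp_log_potential_lt1 a1 z1.
have -> : log_potential a 0 = (circle_mean (log_dist a))%:C.
  rewrite /log_potential circle_integralE.
  have hE t : herglotz 0 t * (log_dist a t)%:C = (log_dist a t)%:C.
    by rewrite /herglotz addr0 subr0 divff ?expi_neq0// mul1r.
  under [X in X +i* _]eq_circle_mean do rewrite hE/=.
  under [X in _ +i* X]eq_circle_mean do rewrite hE/=.
  by rewrite circle_mean_cst.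
rewrite mulr0 subr0 => /(congr1 (@normc R)); rewrite normc_cexp normc1/= => H.
by rewrite -(expRK (circle_mean _)) H ln1.
Qed.

(** As [cos] is injective on each half of the period, a point of the circle has at
    most two arguments in the period. *)
Lemma measure_expi_fiber (R : realType) (a : R[i]) :
  let N : set (measurableTypeR R) := period R `&` [set t | a * expi t = 1] in
  measurable N /\ lebesgue_measure N = 0.
Proof.
move=> N; have cN : countable (N : set R).
  apply: (@sub_countable _ _ _ ([set acos (Re a^-1)] `|` [set 2 * pi - acos (Re a^-1)])).
    apply: subset_card_le => t [It /= at1].
    have a0 : a != 0.
      apply/eqP => a0; move: at1; rewrite a0 mul0r => /esym/eqP.
      by rewrite oner_eq0.
    have <- : cos t = Re a^-1.
      by rewrite -[RHS]/(Re a^-1) -[a^-1](mulr1) -at1 mulKf.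
    move: It; rewrite /= in_itv/= => /andP[t0 t2].
    have [tp|tp] := leP t pi; [left|right].
      by rewrite /= cosK// in_itv/= t0.
    have -> : cos t = cos (2 * pi - t).
      by rewrite cosB mulr_natl cos2pi sin2pi mul0r mul1r addr0.
    rewrite /= cosK; first by ring.
    by rewrite in_itv/=; apply/andP; split; lra.
  by apply: finite_set_countable; rewrite finite_setU; split; exact: finite_set1.
split; last exact: countable_lebesgue_measure0.
by apply: countable_measurable => // t; exact: measurable_set1.
Qed.

(** Moving [x] towards 0 can at most halve its distance to 1. This makes the radial
    approximations of [ln |1 - x|] dominated. *)
Lemma normc_one_sub_radial (R : realType) (r : R) (x : R[i]) :
  0 <= r <= 1 -> normc x <= 1 ->
  normc (1 - x) <= 2 * normc (1 - r%:C * x).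
Proof.
move=> /andP[r0 r1] x1.
have h := normc_one_sub_ge (r%:C * x).
rewrite normcM normc_realE ger0_norm// in h.
have : normc (1 - x) <= normc (1 - r%:C * x) + (1 - r) * normc x.
  rewrite -[1 - r]ger0_norm ?subr_ge0// -normc_realE -normcM.
  have -> : 1 - x = (1 - r%:C * x) - (1 - r)%:C * x.
    by rewrite rmorphB rmorph1; ring.
  by rewrite -[normc ((1 - r)%:C * x)]normc_opp; exact: ler_normcD.
have := normc_ge0 x; nra.
Qed.

Definition radial (R : realType) (n : nat) : R := 1 - harmonic n.

Lemma radial_itv (R : realType) n : 0 <= radial R n <= 1.
Proof.
rewrite /radial subr_ge0 gerBl harmonic_ge0 andbT.
by rewrite /harmonic invf_le1// ler1n.
Qed.

Lemma normc_radial_lt1 (R : realType) n (a : R[i]) :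
  normc a <= 1 -> normc ((radial R n)%:C * a) < 1.
Proof.
move=> a1; have /andP[r0 r1] := radial_itv R n.
rewrite mulrC normcM normc_realE ger0_norm//.
have rl : radial R n < 1 by rewrite gtrBl harmonic_gt0.
have := normc_ge0 a; nra.
Qed.

Lemma log_dist_radial_cvg (R : realType) (a : R[i]) (t : R) :
  normc a <= 1 -> a * expi t != 1 ->
  (fun n => log_dist ((radial R n)%:C * a) t) @ \oo --> log_dist a t.
Proof.
move=> a1 at1; rewrite /log_dist.
have n0 : 0 < normc (1 - a * expi t) by rewrite normc_gt0 subr_eq0 eq_sym.
apply: (@continuous_cvg _ _ _ _ _ (fun n => normc (1 - (radial R n)%:C * a * expi t))).
  exact: continuous_ln.
apply/cvgrPdist_le => e e0.
have /cvgrPdist_le/(_ e e0) [M _ HM] := @cvg_harmonic R.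
exists M => // n /HM /=; rewrite sub0r normrN => he; apply: le_trans he.
have a1t : normc (a * expi t) <= 1 by rewrite normcM normc_expi mulr1.
have hd : normc ((harmonic n)%:C * (a * expi t)) <= `|harmonic n : R|.
  by rewrite normcM normc_realE ler_piMr.
set h : R := harmonic n; set y := 1 - (radial R n)%:C * a * expi t.
have e1 : 1 - a * expi t = y - h%:C * (a * expi t).
  by rewrite /y /radial rmorphB rmorph1 -/h; ring.
have h1 : normc (1 - a * expi t) <= normc y + `|h|.
  rewrite {1}e1; apply: le_trans (ler_normcD _ _) _; rewrite normc_opp.
  by rewrite lerD2l.
have h2 : normc y <= normc (1 - a * expi t) + `|h|.
  have -> : y = (1 - a * expi t) + h%:C * (a * expi t).
    by rewrite e1; ring.
  by apply: le_trans (ler_normcD _ _) _; rewrite lerD2l.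
by rewrite ler_distl; lra.
Qed.

Lemma log_dist_le (R : realType) (a : R[i]) (t : R) : normc a <= 1 ->
  log_dist a t <= ln 2.
Proof.
move=> a1; have [n0|n0] := ltP 0 (normc (1 - a * expi t)).
  by rewrite ler_ln ?posrE// normc_one_sub_le2// normcM_expi.
by rewrite /log_dist ln0// ln_ge0// ler1n.
Qed.

Lemma log_dist_radial_ge (R : realType) (a : R[i]) (t : R) n : normc a <= 1 ->
  a * expi t != 1 ->
  log_dist a t - ln 2 <= log_dist ((radial R n)%:C * a) t.
Proof.
move=> a1 at1.
have n0 : 0 < normc (1 - a * expi t) by rewrite normc_gt0 subr_eq0 eq_sym.
have h : normc (1 - a * expi t) <= 2 * normc (1 - (radial R n)%:C * a * expi t).
  by rewrite -mulrA; apply: normc_one_sub_radial; rewrite ?radial_itv ?normcM_expi.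
have n1 : 0 < normc (1 - (radial R n)%:C * a * expi t) by lra.
by rewrite lerBlDl /log_dist -lnM ?posrE// ler_ln ?posrE// mulr_gt0.
Qed.

(** For [|a| = 1] the logarithm is unbounded, but the estimate of its singularity can
    be avoided. The nonnegative functions [ln 2 - ln |1 - r a w|], for [r < 1], all
    have mean [ln 2] by the mean value property, and Fatou's lemma applies as [r]
    tends to 1. *)
Lemma log_dist_integrable (R : realType) (a : R[i]) : normc a <= 1 ->
  circle_integrable (log_dist a).
Proof.
move=> a1; have [mN N0] := measure_expi_fiber a.
have cst_int c : circle_integrable (fun=> c : R).
  by apply: continuous_circle_integrable => x; exact: cvg_cst.
have ri n : circle_integrable (log_dist ((radial R n)%:C * a)).
  apply: continuous_circle_integrable; apply: continuous_log_dist.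
  exact: normc_radial_lt1.
suff H : circle_integrable (fun t => ln 2 + (-1) * log_dist a t).
  have := circle_integrableD (cst_int (ln 2)) (circle_integrableZ (-1) H).
  by congr circle_integrable; apply/funext => t; ring.
pose g n t := ln 2 + (-1) * log_dist ((radial R n)%:C * a) t.
apply: (@fatou_circle_integrable _ g
   _ _ (ln 2) mN N0).
- apply: measurable_funD => //; apply: measurable_funM => //.
  exact: measurable_log_dist.
- by move=> n; apply: circle_integrableD => //; exact: circle_integrableZ.
- move=> n t _; rewrite /g mulN1r subr_ge0; apply: log_dist_le.
  by apply: ltW; exact: normc_radial_lt1.
- move=> n; rewrite /g circle_meanD//; last exact: circle_integrableZ.
  rewrite circle_meanZ// circle_mean_cst circle_mean_log_dist ?mulr0 ?addr0//.
  exact: normc_radial_lt1.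
- move=> t It Nt; apply: cvgD; first exact: cvg_cst.
  apply: cvgMl_tmp; apply: log_dist_radial_cvg => //.
  by apply/eqP => at1; apply: Nt; split.
Qed.

(** From [|a| < 1] to [|a| <= 1]: replace [a] by [r a] and let [r] tend to 1, with
    [ln 2 + |ln |1 - a w||] dominating the logarithms. *)
Lemma exp_log_potential (R : realType) (a z : R[i]) :
  normc a <= 1 -> normc z < 1 -> cexp (log_potential a z) = 1 - a * z.
Proof.
move=> a1 z1; have [mN N0] := measure_expi_fiber a.
have [c1 c2] := ccont_herglotz z1.
have ui := log_dist_integrable a1.
have cst_int c : circle_integrable (fun=> c : R).
  by apply: continuous_circle_integrable => x; exact: cvg_cst.
have lim (k : R -> R) : continuous k ->
    (fun n => circle_mean (fun t => k t * log_dist ((radial R n)%:C * a) t)) @ \oo -->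
    circle_mean (fun t => k t * log_dist a t).
  move=> ck; have mk := continuous_measurable_period ck.
  have ck' : continuous (fun t => `|k t|).
    by move=> t; apply: continuous_comp; [exact: ck|exact: norm_continuous].
  pose g t := `|k t| * (ln 2 + `|log_dist a t|).
  apply: (@dominated_circle_mean _ _ _ g _ mN N0).
  - by move=> n; apply: measurable_funM => //; exact: measurable_log_dist.
  - by apply: measurable_funM => //; exact: measurable_log_dist.
  - apply: circle_integrableM => //; apply: circle_integrableD => //.
    exact: (integrable_norm ui).
  - move=> n t It Nt; rewrite normrM ler_wpM2l//.
    have at1 : a * expi t != 1 by apply/eqP => at1; apply: Nt; split.
    have h1 := log_dist_radial_ge n a1 at1.
    have h2 : log_dist ((radial R n)%:C * a) t <= ln 2.
      by apply: log_dist_le; apply: ltW; exact: normc_radial_lt1.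
    have h3 := ler_norm (log_dist a t); have h4 := ler_norm (- log_dist a t).
    rewrite normrN in h4; have h5 : 0 <= `|log_dist a t| by [].
    have h6 : 0 <= ln 2 :> R by rewrite ln_ge0// ler1n.
    by rewrite ler_norml; lra.
  - move=> t It Nt; apply: cvgMl_tmp; apply: log_dist_radial_cvg => //.
    by apply/eqP => at1; apply: Nt; split.
have cv : ccvg (fun n => log_potential ((radial R n)%:C * a) z) (log_potential a z).
  have reE b : Re (log_potential b z) =
      circle_mean (fun t => Re (herglotz z t) * log_dist b t).
    by congr circle_mean; apply/funext => t; rewrite cReM mulr0 subr0.
  have imE b : Im (log_potential b z) =
      circle_mean (fun t => Im (herglotz z t) * log_dist b t).
    by congr circle_mean; apply/funext => t; rewrite cImM mulr0 add0r.
  split; [rewrite reE|rewrite imE].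
    by under eq_fun do rewrite reE; exact: lim.
  by under eq_fun do rewrite imE; exact: lim.
apply: ccvg_unique (ccvg_cexp cv) _.
apply: (@ccvg_dist _ _ _ harmonic); first exact: cvg_harmonic.
move=> n; rewrite exp_log_potential_lt1//; last exact: normc_radial_lt1.
have -> : 1 - (radial R n)%:C * a * z - (1 - a * z) = (harmonic n)%:C * (a * z).
  by rewrite /radial rmorphB rmorph1; ring.
rewrite normcM normc_realE ger0_norm ?harmonic_ge0// ler_piMr ?harmonic_ge0//.
by rewrite mulrC ltW// normcM_lt1.
Qed.

(** * Outer functions *)

Lemma outer_one_sub (R : realType) (a : R[i]) : normc a <= 1 ->
  outer (fun x => 1 - a * x).
Proof.
move=> a1; exists 1, (log_dist a); split.
- by rewrite normr1.
- exact: log_dist_integrable.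
- by move=> z /discE_normc z1; rewrite mul1r -exp_log_potential.
Qed.

(** The density is the constant [ln |c|]; the argument of [c] goes into the unimodular
    factor. *)
Lemma outer_cst (R : realType) (c : R[i]) : c != 0 -> outer (fun=> c).
Proof.
move=> c0; have n0 : 0 < normc c by rewrite normc_gt0.
exists (c / `|c|), (fun=> ln (normc c)); split.
- by rewrite normrM normfV normr_id divff// normr_eq0.
- by apply: continuous_circle_integrable => x; exact: cvg_cst.
- move=> z /discE_normc z1.
  have -> : circle_integral (fun t => (expi t + z) / (expi t - z) * (ln (normc c))%:C) =
      (ln (normc c))%:C.
    rewrite -[RHS]mulr1 -(circle_integral_herglotz z1) -circle_integralZ.
      by apply: eq_circle_integral => t _; rewrite mulrC.
    by apply: ccont_integrable; exact: ccont_herglotz.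
  rewrite /cexp /expi/= cos0 sin0 mulr1 lnK ?posrE// norm_normc mulfVK//.
  by rewrite -norm_normc normr_eq0.
Qed.

Lemma outerM (R : realType) (f g : R[i] -> R[i]) : outer f -> outer g ->
  outer (fun x => f x * g x).
Proof.
move=> [c [u [c1 ui fE]]] [d [v [d1 vi gE]]].
exists (c * d), (fun t => u t + v t); split.
- by rewrite normrM c1 d1 mulr1.
- exact: circle_integrableD.
- move=> z dz; rewrite fE// gE//; have z1 := (discE_normc z).1 dz.
  rewrite mulrACA -cexpD -circle_integralD; [|exact: herglotz_integrable..].
  congr (_ * cexp _); apply: eq_circle_integral => t _.
  by rewrite rmorphD mulrDr.
Qed.

Lemma outerV (R : realType) (f : R[i] -> R[i]) : outer f -> outer (fun x => (f x)^-1).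
Proof.
move=> [c [u [c1 ui fE]]].
exists c^-1, (fun t => (-1) * u t); split.
- by rewrite normfV c1 invr1.
- exact: circle_integrableZ.
- move=> z dz; rewrite fE//; have z1 := (discE_normc z).1 dz.
  set H := circle_integral _.
  have -> : circle_integral (fun t => (expi t + z) / (expi t - z) * (-1 * u t)%:C) = - H.
    rewrite -[- H]mulN1r -circle_integralZ; last exact: herglotz_integrable.
    apply: eq_circle_integral => t _.
    by rewrite rmorphM rmorphN rmorph1 mulrCA.
  rewrite invfM; congr (_ * _).
  have E0 : cexp H != 0 by rewrite -normc_gt0 normc_cexp expR_gt0.
  by apply: (mulIf E0); rewrite mulVf// cexpN.
Qed.

Lemma outer_prod (R : realType) (I : Type) (r : seq I) (f : I -> R[i] -> R[i]) :
  (forall i, outer (f i)) -> outer (fun x => \prod_(i <- r) f i x).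
Proof.
move=> fo; elim: r => [|i r IH].
  have := outer_cst (@oner_neq0 R[i]); congr outer.
  by apply/funext => x; rewrite big_nil.
have := outerM (fo i) IH; congr outer.
by apply/funext => x; rewrite big_cons.
Qed.

(** * Complex derivatives and radial limits *)

Definition cderivable (R : realType) (f : R[i] -> R[i]) (x : R[i]) :=
  derivable (f : R[i]^o -> R[i]^o) x 1.

Lemma cderivable_cst (R : realType) (c x : R[i]) : cderivable (fun=> c) x.
Proof. exact: derivable_cst. Qed.

Lemma cderivable_id (R : realType) (x : R[i]) : cderivable (fun y => y) x.
Proof. exact: derivable_id. Qed.

Lemma cderivableD (R : realType) (f g : R[i] -> R[i]) (x : R[i]) :
  cderivable f x -> cderivable g x -> cderivable (fun y => f y + g y) x.
Proof. exact: (@derivableD R[i] (R[i]^o) (R[i]^o) f g x 1). Qed.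

Lemma cderivableM (R : realType) (f g : R[i] -> R[i]) (x : R[i]) :
  cderivable f x -> cderivable g x -> cderivable (fun y => f y * g y) x.
Proof. exact: (@derivableM R[i] (R[i]^o) f g x 1). Qed.

Lemma cderivableV (R : realType) (f : R[i] -> R[i]) (x : R[i]) :
  f x != 0 -> cderivable f x -> cderivable (fun y => (f y)^-1) x.
Proof. exact: (@derivableV R[i] (R[i]^o) f x 1). Qed.

Lemma cderivableX (R : realType) (f : R[i] -> R[i]) (x : R[i]) n :
  cderivable f x -> cderivable (fun y => f y ^+ n) x.
Proof.
move=> df; elim: n => [|n IH].
  by under eq_fun do rewrite expr0; exact: cderivable_cst.
under eq_fun do rewrite exprS.
exact: (cderivableM df IH).
Qed.

Lemma cderivable_prod (R : realType) (I : Type) (r : seq I) (f : I -> R[i] -> R[i])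
    (x : R[i]) :
  (forall i, cderivable (f i) x) -> cderivable (fun y => \prod_(i <- r) f i y) x.
Proof.
move=> df; elim: r => [|i r IH].
  by under eq_fun do rewrite big_nil; exact: cderivable_cst.
under eq_fun do rewrite big_cons.
exact: (cderivableM (df i) IH).
Qed.

(** A function differentiable at a point of the circle is continuous there, so it has
    a radial limit. *)
Lemma boundary_value_cderivable (R : realType) (f : R[i] -> R[i]) (t : R) :
  cderivable f (expi t) -> boundary_value f t (f (expi t)).
Proof.
move=> df; rewrite /boundary_value.
have cf : {for (expi t : R[i]^o), continuous (f : R[i]^o -> R[i]^o)}.
  by apply: differentiable_continuous; apply/derivable1_diffP.
have rad : (fun r : R => r%:C * expi t : R[i]^o) @ 1^'- --> (expi t : R[i]^o).
  apply: cvg_at_left_filter; apply/cvgrPdist_le => /= e e0.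
  (* in the order of the complex numbers, a positive [e] is real *)
  have eE : e = (Re e)%:C.
    by move: e0; case: (e) => a b; rewrite ltcE/= => /andP[/eqP -> _].
  have e0' : 0 < Re e by rewrite -ltcR -eE.
  near=> r.
  have -> : expi t - r%:C * expi t = (1 - r)%:C * expi t.
    by rewrite rmorphB rmorph1; ring.
  rewrite norm_normc normcM_expi normc_realE eE lecR.
  near: r; apply: cvgr_dist_le e0'; exact: cvg_id.
exact: (@cvg_comp _ _ _ (fun r : R => r%:C * expi t : R[i]^o) f _ _ _ rad cf).
Unshelve. all: by end_near. Qed.

(** * The maximum principle for pairs, and extreme points *)

(** The maximum principle for the vector [(a, b)], obtained from the scalar one. Fix
    [z], let [N] be the squared norm of [(a z, b z)], and let [G] be the inner product
    of [(a, b)] with [(a z, b z)]. Then [G z = N], while [Re G <= (N + 1) / 2] on the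
    circle since [2 Re (u' v) <= |u|^2 + |v|^2], with [u'] the conjugate of [u]. So
    [N <= (N + 1) / 2]. *)
Lemma disc_algebra_max_pair (R : realType) (a b : R[i] -> R[i]) :
  disc_algebra a -> disc_algebra b ->
  (forall t, normc (a (expi t)) ^+ 2 + normc (b (expi t)) ^+ 2 <= 1) ->
  forall z, normc z < 1 -> normc (a z) ^+ 2 + normc (b z) ^+ 2 <= 1.
Proof.
move=> da db ab1 z z1; set N := _ + _.
have re (u v : R[i]) : Re (u^* * v) = Re u * Re v + Im u * Im v.
  by rewrite cReM cReJ cImJ mulNr opprK.
pose G x := (a z)^* * a x + (b z)^* * b x.
have dG : disc_algebra G.
  by apply: disc_algebraD; apply: disc_algebraM => //; exact: disc_algebra_cst.
have GN : Re (G z) = N by rewrite /G cReD !re /N !sqr_normcE; ring.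
suff : N <= (N + 1) / 2 by lra.
rewrite -{1}GN; apply: (disc_algebra_max_Re z1 dG) => t.
apply: (@le_trans _ _ ((N + (normc (a (expi t)) ^+ 2 + normc (b (expi t)) ^+ 2)) / 2)).
  rewrite /G cReD !re /N !sqr_normcE.
  have h (x y : R) : x * y <= (x ^+ 2 + y ^+ 2) / 2 by have := sqr_ge0 (x - y); nra.
  have := h (Re (a z)) (Re (a (expi t))); have := h (Im (a z)) (Im (a (expi t))).
  have := h (Re (b z)) (Re (b (expi t))); have := h (Im (b z)) (Im (b (expi t))).
  lra.
by rewrite ler_pM2r ?invr_gt0// lerD2l.
Qed.

Lemma Hinfty_ball_normc (R : realType) (f : R[i] -> R[i]) :
  (forall z, normc z < 1 -> cderivable f z) ->
  (forall z, normc z < 1 -> normc (f z) <= 1) ->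
  Hinfty_ball f.
Proof.
move=> df f1; have H z : disc z -> `|f z| <= 1.
  by move=> /discE_normc /f1; rewrite -lecR.
split=> //; split; last by exists 1.
by move=> z /discE_normc; exact: df.
Qed.

(** Both [b + a^2 / 2] and [b - a^2 / 2] are in the ball, since
    [|b| + |a|^2 / 2 <= (1 + |b|^2) / 2 + |a|^2 / 2 <= 1]. Their half sum is [b], and
    they differ at 0. *)
Lemma not_extreme_of_mate (R : realType) (b a : R[i] -> R[i]) :
  (forall z, normc z < 1 -> cderivable b z) ->
  (forall z, normc z < 1 -> cderivable a z) ->
  (forall z, normc z < 1 -> normc (a z) ^+ 2 + normc (b z) ^+ 2 <= 1) ->
  a 0 != 0 -> ~ extreme_Hinfty_ball b.
Proof.
move=> db da ab1 a0 [_ ext].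
have ball (c : R[i]) : normc c = 2^-1 -> Hinfty_ball (fun x => b x + c * a x ^+ 2).
  move=> c2; apply: Hinfty_ball_normc => z z1.
    apply: cderivableD; first exact: db.
    apply: cderivableM; first exact: cderivable_cst.
    by apply: cderivableX; exact: da.
  apply: le_trans (ler_normcD _ _) _; rewrite normcM normcX c2.
  have := ab1 z z1; have := sqr_ge0 (1 - normc (b z)); nra.
have n2 : normc ((2^-1)%:C : R[i]) = 2^-1 by rewrite normc_realE ger0_norm.
have s01 : 0 < (2^-1 : R) < 1 by lra.
have d0 : disc (0 : R[i]) by apply/discE_normc; rewrite normc0.
have n2N : normc (- (2^-1)%:C : R[i]) = 2^-1 by rewrite normc_opp.
have avg z : disc z -> b z = (2^-1)%:C * (b z + (2^-1)%:C * a z ^+ 2) +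
    (1 - 2^-1)%:C * (b z + - (2^-1)%:C * a z ^+ 2).
  move=> _; have -> : 1 - 2^-1 = 2^-1 :> R by lra.
  by rewrite fmorphV rmorph_nat; field.
have [E _] := ext _ _ 2^-1 (ball _ n2) (ball _ n2N) s01 avg 0 d0.
move: E => /eqP; rewrite -subr_eq0 addrC addKr mulf_eq0 sqrf_eq0 (negbTE a0) orbF.
by apply/negP; rewrite -normc_gt0 n2 invr_gt0.
Qed.

(** * The preimages of the roots of unity under the Koebe function *)

(** Because [k x - k y = (x - y) (1 - x y) / ((1 - x)^2 (1 - y)^2)], where
    [|x y| < 1]. *)
Lemma koebe_inj (R : realType) (x y : R[i]) : normc x < 1 -> normc y < 1 ->
  koebe x = koebe y -> x = y.
Proof.
move=> x1 y1; rewrite /koebe => E.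
have nx := one_sub_neq0 x1; have ny := one_sub_neq0 y1.
have nxy := one_sub_neq0 (normcM_lt1 x1 (ltW y1)).
have : (x - y) * (1 - x * y) = 0.
  have -> : (x - y) * (1 - x * y) =
      (x / (1 - x) ^+ 2 - y / (1 - y) ^+ 2) * ((1 - x) ^+ 2 * (1 - y) ^+ 2).
    by field; rewrite nx ny.
  by rewrite E subrr mul0r.
by move/eqP; rewrite mulf_eq0 (negbTE nxy) orbF subr_eq0 => /eqP.
Qed.

Lemma koebeJ (R : realType) (x : R[i]) : koebe (x^*) = (koebe x)^*.
Proof. by rewrite /koebe rmorphM fmorphV rmorphXn rmorphB rmorph1. Qed.

Lemma prod_roots (R : realType) (m : nat) (w : 'I_m -> R[i]) (e : R[i]) :
  (1 <= m)%N -> injective w -> (forall k, w k ^+ m = e) ->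
  \prod_(k < m) ('X - (w k)%:P) = 'X^m - e%:P.
Proof.
move=> m1 wi we; have sz : size ('X^m - e%:P : {poly R[i]}) = m.+1 by rewrite size_XnsubC.
have szw : size ('X^m - e%:P : {poly R[i]}) = (size (codom w)).+1.
  by rewrite size_codom card_ord.
have rw : all (root ('X^m - e%:P)) (codom w).
  by apply/allP => x /codomP[k ->]; rewrite /root !hornerE we subrr.
have uw : uniq_roots (codom w) by rewrite uniq_rootsE; apply/injectiveP.
rewrite [RHS](all_roots_prod_XsubC szw rw uw) (monicP (monicXnsubC _ m1)) scale1r.
by rewrite /codom /image_mem big_map big_enum.
Qed.

Section Koebe.
Variables (R : realType) (m : nat) (z w : 'I_m -> R[i]).
Hypotheses (m1 : (1 <= m)%N) (wi : injective w)
  (wm : forall k, w k ^+ m = if odd m then 1 else -1)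
  (z1 : forall k, normc (z k) < 1) (zw : forall k, koebe (z k) = w k).

(** The set of the [w k] is that of all the roots of [X^m - 1] or of [X^m + 1], so it
    is stable under conjugation. The Koebe function commutes with conjugation and is
    injective, so the set of the [z k] is stable too. *)
Lemma prod_preimages_conj (f : R[i] -> R[i]) :
  \prod_(k < m) f ((z k)^*) = \prod_(k < m) f (z k).
Proof.
have ex k : exists j, (z k)^* = z j.
  have : \prod_(j < m) ((w k)^* - w j) = 0.
    have /(congr1 (fun p => p.[(w k)^*])) := prod_roots m1 wi wm.
    rewrite horner_prod !hornerE -rmorphXn wm.
    under eq_bigr do rewrite hornerXsubC.
    by move=> ->; case: (odd m); rewrite ?rmorphN rmorph1 subrr.
  move/eqP/prodf_eq0 => [j _]; rewrite subr_eq0 => /eqP wj; exists j.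
  apply: koebe_inj => //; first by rewrite normc_conj.
  by rewrite koebeJ !zw.
have [s zs] := choice ex.
have si : injective s.
  move=> j k sjk; apply: wi; rewrite -!zw; congr koebe.
  by apply: (can_inj (@conjCK R[i])); rewrite !zs sjk.
rewrite [RHS](reindex_inj si); apply: eq_bigr => k _.
by rewrite zs.
Qed.

(** Value of [X^m - 1] (for odd [m]) or [X^m + 1] (for even [m]) at [- 1 / T], cleared
    of denominators. The parity makes the sign of [T^m] the same in both cases. *)
Lemma prod_one_add_root (T : R[i]) : \prod_(k < m) (1 + w k * T) = 1 + T ^+ m.
Proof.
(* [- 1 / T] makes no sense when [T = 0], but then both sides are 1 *)
have [->|T0] := eqVneq T 0.
  rewrite expr0n gtn_eqF// addr0 big1// => k _.
  by rewrite mulr0 addr0.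
have /(congr1 (fun p => p.[- T^-1])) := prod_roots m1 wi wm.
rewrite horner_prod !hornerE.
under eq_bigr do rewrite hornerXsubC.
move=> H.
have -> : \prod_(k < m) (1 + w k * T) = (- T) ^+ m * \prod_(k < m) (- T^-1 - w k).
  have -> : (- T) ^+ m = \prod_(k < m) (- T) by rewrite prodr_const card_ord.
  rewrite -big_split/=; apply: eq_bigr => k _.
  by field.
rewrite H mulrBr -exprMn mulrNN divff// expr1n [(- T) ^+ m]exprNn.
have -> : (-1) ^+ m = (-1) ^+ (odd m) :> R[i] by rewrite signr_odd.
by case: (odd m); rewrite ?expr1 ?expr0; ring.
Qed.

Let C := \prod_(k < m) (1 - z k).

Lemma prod_one_sub_neq0 : C != 0.
Proof. by apply/prodf_neq0 => k _; exact: one_sub_neq0. Qed.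

Lemma prod_one_sub_conj : C^* = C.
Proof.
rewrite /C rmorph_prod -(prod_preimages_conj (fun x => 1 - x)).
by apply: eq_bigr => k _; rewrite rmorphB rmorph1.
Qed.

Lemma prod_one_subM_neq0 (x : R[i]) : normc x <= 1 -> \prod_(k < m) (1 - z k * x) != 0.
Proof. by move=> x1; apply/prodf_neq0 => k _; apply/one_sub_neq0/normcM_lt1. Qed.

(** Let [T = |1 - x|^2] and let [x'] be the conjugate of [x]. As [|x| = 1], each
    factor [(1 - z x) (1 - z x')] equals [(1 - z)^2 (1 + k(z) T)]. By symmetry the
    product of the [1 - z x'] is the conjugate of that of the [1 - z x], and the
    factors [1 + w T] multiply to [1 + T^m]. *)
Lemma normc_prod_circle (x : R[i]) : normc x = 1 ->
  normc (\prod_(k < m) (1 - z k * x)) ^+ 2 =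
  normc C ^+ 2 * (1 + normc (1 - x) ^+ (2 * m)).
Proof.
move=> x1; apply: complexI.
have sq (y : R[i]) : (normc y ^+ 2)%:C = y * y^* by rewrite rmorphXn/= -norm_normc normCK.
have xx : x * x^* = 1 by rewrite -sq x1 expr1n.
set T : R[i] := (normc (1 - x) ^+ 2)%:C.
have TE : T = 2 - x - x^*.
  by rewrite /T sq rmorphB rmorph1 mulrBl mul1r mulrBr mulr1 xx; ring.
have -> : (normc C ^+ 2 * (1 + normc (1 - x) ^+ (2 * m)))%:C =
    (normc C ^+ 2)%:C * (1 + T ^+ m).
  by rewrite rmorphM/= rmorphD/= rmorph1 exprM [in X in _ = X]/T -[in RHS]rmorphXn.
rewrite !sq prod_one_sub_conj rmorph_prod.
have -> : \prod_(k < m) (1 - z k * x)^* = \prod_(k < m) (1 - z k * x^*).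
  rewrite -(prod_preimages_conj (fun y => 1 - y * x^*)).
  by apply: eq_bigr => k _; rewrite rmorphB rmorphM rmorph1.
rewrite -prod_one_add_root -!big_split/=; apply: eq_bigr => k _.
have nz := one_sub_neq0 (z1 k).
have -> : (1 - z k * x) * (1 - z k * x^*) =
    1 - z k * (x + x^*) + z k ^+ 2 * (x * x^*) by ring.
by rewrite xx -zw /koebe TE; field.
Qed.

(** The product of the [1 - z k] is real, by conjugation. Replacing [z k] by [s (z k)]
    joins it to 1 through real numbers when [s] runs through the unit interval, and
    none of these is 0. *)
Lemma prod_one_sub_gt0 : 0 < C.
Proof.
have CE : C = (Re C)%:C.
  apply: complex_ext => //=; have /(congr1 (@complex.Im R)) := prod_one_sub_conj.
  by rewrite cImJ; lra.
suff C0 : 0 < Re C by rewrite CE ltcR.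
rewrite ltNge; apply/negP => Cle.
pose p : {poly R[i]} := \prod_(k < m) (1 - (z k) *: 'X).
have pE x : p.[x] = \prod_(k < m) (1 - z k * x).
  rewrite horner_prod; apply: eq_bigr => k _.
  by rewrite hornerD hornerN hornerC hornerZ hornerX.
pose f (s : R) := Re p.[s%:C].
have cf : {within `[0, 1], continuous f}.
  apply: continuous_subspaceT => s; apply: differentiable_continuous.
  by apply/derivable1_diffP; have [[]] := is_cderive_horner p s.
have f0 : f 0 = 1.
  by rewrite /f pE big1// => k _; rewrite mulr0 subr0.
have f1 : f 1 = Re C.
  by rewrite /f pE; congr (Re _); apply: eq_bigr => k _; rewrite mulr1.
have [|s s01 fs] := @IVT R f 0 1 0 ler01 cf.
  by rewrite f0 f1 ge_min le_max ler01 Cle orbT.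
have ps : p.[s%:C] = 0.
  apply: complex_ext => //=.
  have : p.[s%:C]^* = p.[s%:C].
    rewrite pE rmorph_prod -(prod_preimages_conj (fun x => 1 - x * s%:C)).
    apply: eq_bigr => k _; rewrite rmorphB rmorphM rmorph1; congr (1 - _ * _).
    exact: conjc_real.
  by move/(congr1 (@complex.Im R)); rewrite cImJ; lra.
move: ps; rewrite pE => /eqP; apply/negP; apply: prod_one_subM_neq0 => //.
move: s01; rewrite in_itv/= => /andP[s0 s1].
by apply: le_trans (_ : `|s| <= 1); [rewrite -normc_realE|rewrite ger0_norm].
Qed.
End Koebe.

(** * The canonical representation *)

Theorem proposition1 (R : realType) (lambda : R[i]) (m : nat)
    (z w : 'I_m -> R[i]) :
  `|lambda| = 1 ->
  (1 <= m)%N ->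
  injective w ->
  (forall k, w k ^+ m = if odd m then 1 else -1) ->
  (forall k, disc (z k)) ->
  (forall k, koebe (z k) = w k) ->
  let C_m := \prod_(k < m) (1 - z k) in
  canonical_representation
    (fun x => (lambda^* * x) ^+ m / (1 - lambda^* * x) ^+ m)
    (fun x => C_m * (lambda^* * x) ^+ m
              / \prod_(k < m) (1 - lambda^* * z k * x))
    (fun x => C_m * (1 - lambda^* * x) ^+ m
              / \prod_(k < m) (1 - lambda^* * z k * x)).
Proof.
move=> l1 m1 wi wm zD zw C_m.
have z1 k : normc (z k) < 1 by apply/discE_normc.
set b := (fun x => C_m * (lambda^* * x) ^+ m / _).
set a := (fun x => C_m * (1 - lambda^* * x) ^+ m / _).
set be := lambda^* in b a *.
have be1 : normc be = 1.
  by apply: complexI; rewrite -norm_normc norm_conjC l1.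
have C0 := prod_one_sub_neq0 z1; have Cp := prod_one_sub_gt0 m1 wi wm z1 zw.
have dn x : normc x <= 1 -> \prod_(k < m) (1 - be * z k * x) != 0.
  move=> x1; under eq_bigr do rewrite mulrAC [be * x * _]mulrC.
  by apply: prod_one_subM_neq0 => //; rewrite normcM be1 mul1r.
have bz k : normc (be * z k) < 1 by rewrite normcM be1 mul1r.
have lin (c x : R[i]) : cderivable (fun y => 1 - c * y) x.
  have dcx := cderivableM (@cderivable_cst R (- c) x) (@cderivable_id R x).
  have := cderivableD (@cderivable_cst R 1 x) dcx.
  by under eq_fun do rewrite mulNr.
have dden x : normc x <= 1 ->
    cderivable (fun y => (\prod_(k < m) (1 - be * z k * y))^-1) x.
  move=> x1; apply: cderivableV; first exact: dn.
  by apply: cderivable_prod => k; exact: lin.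
have db x : normc x <= 1 -> cderivable b x.
  move=> x1; apply: cderivableM; last exact: dden.
  apply: cderivableM; first exact: cderivable_cst.
  apply: cderivableX; apply: cderivableM; [exact: cderivable_cst|exact: cderivable_id].
have da x : normc x <= 1 -> cderivable a x.
  move=> x1; apply: cderivableM; last exact: dden.
  by apply: cderivableM; [exact: cderivable_cst|apply: cderivableX; exact: lin].
have linA (c : R[i]) : disc_algebra (fun y => 1 - c * y).
  have dcx := disc_algebraM (disc_algebra_cst (- c)) (disc_algebra_id R).
  have := disc_algebraD (disc_algebra_cst 1) dcx.
  by under eq_fun do rewrite mulNr.
have denA : disc_algebra (fun y => (\prod_(k < m) (1 - be * z k * y))^-1).
  under eq_fun do rewrite -prodfV.
  by apply: disc_algebra_prod => k; exact: disc_algebra_geom.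
have bA : disc_algebra b.
  apply: disc_algebraM denA; apply: disc_algebraM; first exact: disc_algebra_cst.
  apply: disc_algebraX.
  by apply: disc_algebraM; [exact: disc_algebra_cst|exact: disc_algebra_id].
have aA : disc_algebra a.
  apply: disc_algebraM denA; apply: disc_algebraM; first exact: disc_algebra_cst.
  by apply: disc_algebraX; exact: linA.
have circ t : normc (a (expi t)) ^+ 2 + normc (b (expi t)) ^+ 2 = 1.
  have x1 : normc (be * expi t) = 1 by rewrite normcM_expi.
  have := normc_prod_circle m1 wi wm z1 zw x1; rewrite -/C_m.
  have d0 := dn _ (normc_expi_le1 t).
  have -> : \prod_(k < m) (1 - z k * (be * expi t)) =
      \prod_(k < m) (1 - be * z k * expi t).
    by apply: eq_bigr => k _; congr (1 - _); ring.
  rewrite /a /b !normcM !normcV !normcX x1 expr1n mulnC exprM.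
  set q := \prod_(k < m) _; rewrite -/q in d0 *; rewrite -normc_gt0 in d0.
  move=> H; have q0 : normc q != 0 by rewrite gt_eqF.
  rewrite !exprMn !exprVn -mulrDl H expr1n.
  by rewrite addrC -mulrDr divff// -H expf_neq0.
have ab1 x : normc x < 1 -> normc (a x) ^+ 2 + normc (b x) ^+ 2 <= 1.
  by apply: disc_algebra_max_pair => // t; rewrite circ.
have bb : Hinfty_ball b.
  apply: Hinfty_ball_normc => x x1; first by apply: db; exact: ltW.
  have := ab1 x x1; have := sqr_ge0 (normc (a x)); have := normc_ge0 (b x); nra.
have ba : Hinfty_ball a.
  apply: Hinfty_ball_normc => x x1; first by apply: da; exact: ltW.
  have := ab1 x x1; have := sqr_ge0 (normc (b x)); have := normc_ge0 (a x); nra.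
have oa : outer a.
  apply: outerM; last first.
    by apply: outerV; apply: outer_prod => k; apply: outer_one_sub; exact: ltW.
  apply: outerM; first exact: outer_cst.
  have -> : (fun x => (1 - be * x) ^+ m) = (fun x => \prod_(k < m) (1 - be * x)).
    by apply/funext => x; rewrite prodr_const card_ord.
  by apply: outer_prod => k; apply: outer_one_sub; rewrite be1.
have aq : 0 < a 0.
  rewrite /a mulr0 subr0 expr1n mulr1 big1 ?divr1// => k _.
  by rewrite mulr0 subr0.
have fac x : disc x -> (be * x) ^+ m / (1 - be * x) ^+ m = b x / a x.
  move=> /discE_normc x1; rewrite /a /b.
  have n1 : (1 - be * x) ^+ m != 0.
    by rewrite expf_neq0// one_sub_neq0// normcM be1 mul1r.
  have := dn x (ltW x1); set q := \prod_(k < m) _ => q0.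
  by field; rewrite q0 C0 n1.
split.
- by exists b, a; split => //; [case: bb|case: ba].
- exists (2^-1)%:C; first by apply/discE_normc; rewrite normc_realE ger0_norm//; lra.
  have h : normc (be * (2^-1)%:C) < 1.
    by rewrite normcM be1 mul1r normc_realE ger0_norm//; lra.
  rewrite mulf_neq0 ?invr_eq0 ?expf_neq0 ?one_sub_neq0//.
  by rewrite -normc_gt0 normcM be1 mul1r normc_realE ger0_norm//; lra.
- split => //.
  + apply: (@not_extreme_of_mate _ b a) => //.
    * by move=> x x1; apply: db; exact: ltW.
    * by move=> x x1; apply: da; exact: ltW.
    * by rewrite gt_eqF.
  + by split => //; case: ba.
  + apply: aeW => t _; exists (a (expi t)), (b (expi t)); split.
    * by apply: boundary_value_cderivable; apply: da; exact: normc_expi_le1.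
    * by apply: boundary_value_cderivable; apply: db; exact: normc_expi_le1.
    * by rewrite !norm_normc -!rmorphXn -rmorphD circ.
- exact: fac.
Qed.
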